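(* Let $u,w\in S_n$ be such that $u\le w$ in Bruhat order, and let $\beta(w),\beta(u^{-1}w_0),\beta(w^* )$ be positive reduced lifts of $w$, $u^{-1}w_0$, $w^*$. Let $\iota$ be the map sending $(z_1,z_2)\in\mathbb C^{\ell(w)}\times\mathbb C^{\ell(u^{-1}w_0)}$ to the flag $\mathcal F^{B_{\beta(w)}^{-1}(z_1)}$, and let $\jmath$ be the map sending $(z_1,z_2)\in\mathbb C^{\ell(u^{-1}w_0)}\times\mathbb C^{\ell(w^* )}$ to the flag $\mathcal F^{w_0B_{\beta(u^{-1}w_0)}^{-1}(z_1)}$. Then these maps restrict to isomorphisms of affine algebraic varieties $$\iota:X(\beta(w)\beta(u^{-1}w_0);w_0)\xrightarrow{\ \sim\ }\mathcal R^\circ(u^{-1},w^{-1}),\qquad \jmath:X(\beta(u^{-1}w_0)\beta(w^* );w_0)\xrightarrow{\ \sim\ }\mathcal R^\circ(u,w).$$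
   Context: $G=\mathrm{GL}(n,\mathbb C)$, $B$ and $B_-$ are the subgroups of upper, resp. lower, triangular matrices, $\mathcal{F}\ell_n=G/B$. For $A\in G$, $\mathcal F^A\in\mathcal{F}\ell_n$ is the flag whose $i$-th subspace is spanned by the first $i$ columns of $A$. Permutations are identified with permutation matrices and multiplied as functions; $w_0\in S_n$ is the longest element and $w^*:=w_0ww_0$. The open Richardson variety is $\mathcal R^\circ(u,w):=(BwB/B)\cap(B_-uB/B)\subset\mathcal{F}\ell_n$. $\beta(v)$ denotes a positive braid word obtained from a reduced expression of $v$ by replacing $s_i$ with $\sigma_i$. $B_i(z)\in\mathrm{GL}(n,\mathbb C[z])$ is the identity except for the block $\begin{pmatrix}0&1\\1&z\end{pmatrix}$ in rows and columns $i,i+1$; for a positive word $\gamma=\sigma_{a_1}\cdots\sigma_{a_m}$, $B_\gamma(z)=B_{a_1}(z_1)\cdots B_{a_m}(z_m)$. The braid variety is $X(\gamma;\pi)=\{z\in\mathbb C^m: B_\gamma(z)\pi\text{ is upper triangular}\}$ for $\pi\in S_n$. *)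

(* Defs.v *)
From mathcomp Require Import all_boot all_order all_fingroup all_algebra.
From mathcomp Require Import classical_sets reals complex mpoly.

Set Implicit Arguments.
Unset Strict Implicit.
Unset Printing Implicit Defensive.

Import GRing.Theory.
Local Open Scope ring_scope.
Local Open Scope classical_set_scope.

(* Varieties are treated classically, as spaces with functions: a set, its
   Zariski-open subsets, and for each open U the K-valued functions regular on
   U. A function on U is represented by a total function, whose values outside
   U are irrelevant. *)
Record space_with_functions (K : fieldType) := SpaceWithFunctions {
  points :> Type;
  is_open : set points -> Prop;
  regular : set points -> (points -> K) -> Prop
}.

Section SpacesWithFunctions.
Variable K : fieldType.
Implicit Types X Y : space_with_functions K.

Definition is_morphism X Y (f : X -> Y) : Prop :=
  forall V : set Y, is_open V ->
    is_open (f @^-1` V) /\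
    (forall h : Y -> K, regular V h -> regular (f @^-1` V) (h \o f)).

Definition is_isomorphism X Y (f : X -> Y) : Prop :=
  is_morphism f /\
  exists g : Y -> X, [/\ cancel f g, cancel g f & is_morphism g].

Definition zariski_open m (U : set 'rV[K]_m) : Prop :=
  exists S : set {mpoly K[m]},
    U = [set x | exists2 p, S p & p.@[x 0] != 0].

(* regular = locally a quotient of two polynomials *)
Definition zariski_regular m (U : set 'rV[K]_m) (f : 'rV[K]_m -> K) : Prop :=
  forall x, U x -> exists V (p q : {mpoly K[m]}),
    [/\ zariski_open V, V x & forall y, U y -> V y ->
        q.@[y 0] != 0 /\ f y = p.@[y 0] / q.@[y 0]].

Definition affine_space m : space_with_functions K :=
  @SpaceWithFunctions K 'rV[K]_m (@zariski_open m) (@zariski_regular m).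

(* The structure induced on T by an injection j into X: the regular functions
   are those which locally extend to regular functions on open sets of X. *)
Definition induced_space (T : Type) X (j : T -> X) : space_with_functions K :=
  @SpaceWithFunctions K T
    (fun U => exists2 V, is_open V & U = j @^-1` V)
    (fun U f => forall t, U t -> exists V (h : X -> K),
       [/\ is_open V, V (j t), regular V h &
           forall s, U s -> V (j s) -> f s = h (j s)]).

Definition subspace X (A : set X) : space_with_functions K :=
  @induced_space A X (fun x : A => val x).

(* The structure of quotient variety on the target of a surjection p. *)
Definition quotient_space X (T : Type) (p : X -> T) : space_with_functions K :=
  @SpaceWithFunctions K T
    (fun U => is_open (p @^-1` U))
    (fun U f => regular (p @^-1` U) (f \o p)).

Definition restricts_to_isomorphism X Y (A : set X) (B : set Y) (f : X -> Y) :
  Prop :=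
  exists2 g : subspace A -> subspace B,
    forall x : A, val (g x : B) = f (val x) & is_isomorphism g.

End SpacesWithFunctions.

Section SymmetricGroup.
Variable n : nat.

(* MathComp composes permutations from left to right: (v * u) x = u (v x). *)
Definition perm_comp (u v : 'S_n) : 'S_n := (v * u)%g.

Lemma perm_compE u v x : perm_comp u v x = u (v x).
Proof. exact: permM. Qed.

Definition longest_perm : 'S_n := perm (@rev_ord_inj n).

Definition perm_star (w : 'S_n) : 'S_n :=
  perm_comp longest_perm (perm_comp w longest_perm).

(* The i-th generator (i < n - 1, counted from 0) involves the two ordinals
   with values i and i.+1. *)
Definition ord_fst (i : 'I_n.-1) : 'I_n := widen_ord (leq_pred n) i.

Lemma ord_snd_subproof (i : 'I_n.-1) : (i.+1 < n)%N.
Proof. by rewrite -ltn_predRL. Qed.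

Definition ord_snd (i : 'I_n.-1) : 'I_n := Ordinal (ord_snd_subproof i).

Definition simple_refl (i : 'I_n.-1) : 'S_n := tperm (ord_fst i) (ord_snd i).

Definition word_perm (a : seq 'I_n.-1) : 'S_n :=
  foldr (fun i v => perm_comp (simple_refl i) v) 1%g a.

Lemma word_perm_cat a b :
  word_perm (a ++ b) = perm_comp (word_perm a) (word_perm b).
Proof.
rewrite /perm_comp; elim: a => [|i a IHa] /=; first by rewrite mulg1.
by rewrite IHa /perm_comp mulgA.
Qed.

Lemma tperm_word (d : nat) (i j : 'I_n) :
  (i + d)%N = j :> nat -> exists a, word_perm a = tperm i j.
Proof.
elim: d i j => [|d IHd] i j Eij.
  exists [::] => /=; suff ->: i = j by rewrite tperm1.
  by apply: val_inj; rewrite /= -Eij addn0.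
have lt_in : (i < n.-1)%N.
  by rewrite ltn_predRL (leq_ltn_trans _ (ltn_ord j)) // -Eij addnS ltnS leq_addr.
pose k := Ordinal lt_in.
have Ei : ord_fst k = i by apply: val_inj.
have [|a Ea] := IHd (ord_snd k) j; first by rewrite /= addSnnS.
case: d Eij {IHd} => [|d] Eij.
  exists [:: k]; rewrite /= /perm_comp mul1g /simple_refl Ei.
  by congr tperm; apply: val_inj; rewrite /= -Eij addn1.
exists ([:: k] ++ a ++ [:: k]).
rewrite !word_perm_cat Ea /perm_comp /= /perm_comp !mul1g.
have -> : (simple_refl k * tperm (ord_snd k) j * simple_refl k)%g
          = (tperm (ord_snd k) j ^ simple_refl k)%g.
  by rewrite conjgE /simple_refl tpermV mulgA.
rewrite tpermJ /simple_refl tpermR.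
rewrite tpermD ?Ei // -val_eqE /= -Eij.
  by rewrite -[X in X == _]addn0 eqn_add2l.
by rewrite -addn1 eqn_add2l.
Qed.

Lemma word_exists (v : 'S_n) :
  exists k, [exists a : k.-tuple 'I_n.-1, word_perm a == v].
Proof.
suff [a <-]: exists a, word_perm a = v.
  by exists (size a); apply/existsP; exists (in_tuple a).
have [ts -> _] := prod_tpermP v; elim: ts => [|[i j] ts [a Ea]].
  by exists [::]; rewrite big_nil.
have [b Eb] : exists b, word_perm b = tperm i j.
  have [le_ij | /ltnW le_ji] := leqP i j.
    by apply: (@tperm_word (j - i)); rewrite subnKC.
  by rewrite tpermC; apply: (@tperm_word (i - j)); rewrite subnKC.
by exists (a ++ b); rewrite big_cons word_perm_cat /perm_comp Ea Eb.
Qed.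

Definition perm_length (v : 'S_n) : nat := ex_minn (word_exists v).

Definition bruhat_step (v v' : 'S_n) : bool :=
  [exists i, exists j, [&& i != j, v' == perm_comp v (tperm i j)
                         & (perm_length v < perm_length v')%N]].

Definition bruhat_le (u w : 'S_n) : bool := connect bruhat_step u w.

End SymmetricGroup.

Section Flags.
Variables (K : fieldType) (n : nat).

Definition is_flag (F : {ffun 'I_n.+1 -> {vspace 'cV[K]_n}}) : bool :=
  [forall i : 'I_n.+1, \dim (F i) == i] &&
  [forall i : 'I_n.+1, forall j : 'I_n.+1, (i <= j)%N ==> (F i <= F j)%VS].

Definition flag := {F : {ffun 'I_n.+1 -> {vspace 'cV[K]_n}} | is_flag F}.

Definition GL := {A : 'M[K]_n | A \in unitmx}.

Definition columns (A : 'M[K]_n) : seq 'cV[K]_n :=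
  [seq col j A | j <- enum 'I_n].

Definition column_spans (A : 'M[K]_n) : {ffun 'I_n.+1 -> {vspace 'cV[K]_n}} :=
  [ffun i : 'I_n.+1 => <<take i (columns A)>>%VS].

Lemma columns_free (A : 'M[K]_n) : A \in unitmx -> free (columns A).
Proof.
move=> uA; have sA : size (columns A) == n by rewrite size_map size_enum_ord.
rewrite -[columns A]/(tval (Tuple sA)); apply/freeP => k Ek.
suff E0 : \col_i k i = 0 :> 'cV[K]_n.
  by move=> i; have := congr1 (fun M : 'cV_n => M i 0) E0; rewrite !mxE.
apply: (can_inj (mulKmx uA)); rewrite mulmx0 -[RHS]Ek.
apply/matrixP => r c; rewrite mxE summxE; apply: eq_bigr => i _.
rewrite (nth_map i) ?size_enum_ord //= nth_ord_enum !mxE.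
by rewrite mulrC.
Qed.

Lemma column_spans_flag (A : GL) : is_flag (column_spans (val A)).
Proof.
have fA := columns_free (valP A).
apply/andP; split; apply/forallP => i.
  rewrite ffunE; move: fA; rewrite -{1}(cat_take_drop i (columns _)).
  move=> /catl_free /eqP ->.
  by rewrite size_takel // size_map size_enum_ord -ltnS.
apply/forallP => j; apply/implyP => le_ij; rewrite !ffunE.
apply: sub_span => x; rewrite -[X in _ -> x \in take X _](subnKC le_ij) takeD.
by rewrite mem_cat => ->.
Qed.

Definition flag_of (A : GL) : flag :=
  exist (fun F => is_flag F) _ (column_spans_flag A).

Definition GL_inv (A : GL) : GL :=
  exist (fun M => M \in unitmx) (invmx (val A)) (etrans (unitmx_inv (val A)) (valP A)).

Lemma GL_mul_subproof (A B : GL) : val A *m val B \in unitmx.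
Proof. by rewrite unitmx_mul (valP A) (valP B). Qed.

Definition GL_mul (A B : GL) : GL := exist (fun M => M \in unitmx) _ (GL_mul_subproof A B).

(* The permutation matrix with columns P e_j = e_{v j}, so that products of
   matrices correspond to perm_comp; MathComp's perm_mx v is its transpose. *)
Definition pmx (v : 'S_n) : 'M[K]_n := perm_mx v^-1.

Lemma pmxE v i j : pmx v i j = (i == v j)%:R.
Proof. by rewrite !mxE (canF_eq (permKV v)). Qed.

Definition GL_perm (v : 'S_n) : GL := exist (fun M => M \in unitmx) (pmx v) (unitmx_perm K v^-1).

(* GL_n is open in the affine space of n x n matrices, and the flag variety
   G/B is the quotient of GL_n by A |-> F^A, whose fibres are the cosets AB. *)
Definition GL_space : space_with_functions K :=
  @induced_space K GL (affine_space K (n * n)) (fun A => mxvec (val A)).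

Definition flag_variety : space_with_functions K :=
  @quotient_space K GL_space flag flag_of.

Definition upper_tri (A : 'M[K]_n) : bool := is_trig_mx A^T.
Definition lower_tri (A : 'M[K]_n) : bool := is_trig_mx A.

Definition schubert_cell (w : 'S_n) : set flag :=
  flag_of @` [set A | exists b c : GL,
    [/\ upper_tri (val b), upper_tri (val c) &
        A = GL_mul (GL_mul b (GL_perm w)) c]].

Definition opposite_cell (u : 'S_n) : set flag :=
  flag_of @` [set A | exists b c : GL,
    [/\ lower_tri (val b), upper_tri (val c) &
        A = GL_mul (GL_mul b (GL_perm u)) c]].

Definition open_richardson (u w : 'S_n) : set flag_variety :=
  schubert_cell w `&` opposite_cell u.

Definition elem_braid_mx (i : 'I_n.-1) (z : K) : 'M[K]_n :=
  \matrix_(r, c)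
    if (r == ord_fst i) && (c == ord_fst i) then 0
    else if (r == ord_fst i) && (c == ord_snd i) then 1
    else if (r == ord_snd i) && (c == ord_fst i) then 1
    else if (r == ord_snd i) && (c == ord_snd i) then z
    else (r == c)%:R.

Definition braid_mx m (a : m.-tuple 'I_n.-1) (z : 'rV[K]_m) : 'M[K]_n :=
  \big[mulmx/1%:M]_(k < m) elem_braid_mx (tnth a k) (z 0 k).

Lemma elem_braid_mxE i z :
  elem_braid_mx i z =
  (1%:M + z *: delta_mx (ord_snd i) (ord_fst i)) *m pmx (simple_refl i).
Proof.
have ne : (ord_snd i == ord_fst i) = false by rewrite -val_eqE /= gtn_eqF.
rewrite mulmxDl mul1mx -scalemxAl; apply/matrixP => r c.
rewrite mxE [RHS]mxE pmxE [X in _ = _ + X]mxE.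
rewrite [X in _ * X](_ : _ = (r == ord_snd i)%:R * (c == ord_snd i)%:R); last first.
  rewrite mxE (bigD1 (ord_fst i)) //= big1 => [|k nk]; last first.
    by rewrite mxE (negPf nk) andbF mul0r.
  rewrite mxE eqxx andbT addr0 pmxE; congr (_ * _%:R).
  by rewrite eq_sym (canF_eq (tpermK _ _)) tpermL.
rewrite /simple_refl; case: tpermP => [->|->|/eqP nf /eqP ns].
- rewrite eqxx [ord_fst i == _]eq_sym ne !andbT !andbF /= mulr0 mulr0 addr0.
  have [->|nr] := eqVneq r (ord_fst i).
    by rewrite [ord_fst i == _]eq_sym ne.
  by have [_|_] := eqVneq r (ord_snd i).
- rewrite eqxx ne !andbT !andbF mulr1.
  have [->|nr] := eqVneq r (ord_fst i).
    by rewrite [_ == ord_snd i]eq_sym ne mulr0 addr0.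
  by have [_|_] := eqVneq r (ord_snd i); rewrite /= ?mulr1 ?mulr0 ?add0r ?addr0.
- by rewrite (negPf nf) (negPf ns) !andbF !mulr0 addr0.
Qed.

Lemma elem_braid_mx_unit i z : elem_braid_mx i z \in unitmx.
Proof.
rewrite elem_braid_mxE unitmx_mul unitmx_perm andbT unitmxE.
have ne : (ord_fst i == ord_snd i) = false by rewrite -val_eqE /= ltn_eqF.
rewrite det_trig ?big1 ?unitr1 // => [k _|].
  rewrite !mxE eqxx; case: eqP => [->|]; last by rewrite mulr0 addr0.
  by rewrite [_ == ord_fst i]eq_sym ne mulr0 addr0.
apply/is_trig_mxP => r c lt_rc; rewrite !mxE -val_eqE ltn_eqF // add0r.
case: eqP => [Er|_]; last by rewrite mulr0.
case: eqP => [Ec|_]; last by rewrite mulr0.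
by move: lt_rc; rewrite Er Ec /= ltnNge leqnSn.
Qed.

Lemma braid_mx_unit m (a : m.-tuple 'I_n.-1) z : braid_mx a z \in unitmx.
Proof.
rewrite /braid_mx; elim/big_ind: _ => [|A B uA uB|k _]; first exact: unitmx1.
  by rewrite unitmx_mul uA.
exact: elem_braid_mx_unit.
Qed.

Definition GL_braid m (a : m.-tuple 'I_n.-1) (z : 'rV[K]_m) : GL :=
  exist (fun M => M \in unitmx) _ (braid_mx_unit a z).

Definition braid_variety m (a : m.-tuple 'I_n.-1) (v : 'S_n) :
  set (affine_space K m) :=
  [set z : 'rV[K]_m | upper_tri (braid_mx a z *m pmx v)].

(* The source K^p x K^q of both maps is K^(p + q); lsubmx z and rsubmx z are
   the two components of z. *)
Definition iota_map p q (a : p.-tuple 'I_n.-1) :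
  affine_space K (p + q) -> flag_variety :=
  fun z : 'rV[K]_(p + q) => flag_of (GL_inv (GL_braid a (lsubmx z))).

Definition jmath_map p q (b : p.-tuple 'I_n.-1) :
  affine_space K (p + q) -> flag_variety :=
  fun z : 'rV[K]_(p + q) =>
    flag_of (GL_mul (GL_perm (longest_perm n)) (GL_inv (GL_braid b (lsubmx z)))).

End Flags.

(* Main.v *)
Require Import Defs.
From mathcomp Require Import all_boot all_order all_fingroup all_algebra.
From mathcomp Require Import classical_sets reals complex mpoly zify.

Set Implicit Arguments.
Unset Strict Implicit.
Unset Printing Implicit Defensive.

Import GRing.Theory.
Local Open Scope ring_scope.
Local Open Scope classical_set_scope.

(** The idea is that both maps compare two parametrizations of cells by the same
    matrices. A reduced word for [v] gives a braid matrix [B(z)] for which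
    [v^-1 B(z)] is upper unipotent and [B(z) v^-1] is lower unipotent
    ([braid_word_unip_upper], [braid_word_unip_lower]). Hence, for a permutation
    [g], the flag of [g B(z)^-1] lies in [g B v^-1 B / B] and the flag of
    [g B(z) w0] lies in [g B_- v w0 B / B]. For [g = 1] and [g = w0] these are
    Schubert and opposite cells, and each of them is parametrized bijectively by
    [z] ([inv_braid_cell_param], [braid_cell_param]).

    The matrix [B_1(z1) B_2(z2) w0] is upper triangular exactly when the flags of
    [B_1(z1)^-1] and of [B_2(z2) w0] agree ([flag_of_eq]), and multiplying both
    matrices on the left by [w0] changes nothing. So a point of the braid variety
    is a flag that lies in a Schubert cell and in an opposite cell, together with
    its parameters [z1] in one of them and [z2] in the other: the braid
    variety is the graph of the identity of the intersection of the cells, that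
    is, of the open Richardson variety ([richardson_isomorphism]).

    Onto-ness of a parametrization is Bruhat decomposition, one letter at a time
    ([simple_refl_upper]). Its inverse is regular for two reasons. The parameters
    of a reduced word are successively entries of the braid matrix, after the
    letters already read have been divided out ([braid_paramsK]). And the cell of
    [v] lies in the open set [v U_- B / B], where the lower unipotent factor is a
    regular function of the flag ([lower_factor]). *)

(** * Triangular matrices and flags *)

Section Triangular.
Variables (K : fieldType) (n : nat).
Implicit Types A B : 'M[K]_n.

Lemma upperP A :
  reflect (forall i j : 'I_n, (j < i)%N -> A i j = 0) (upper_tri A).
Proof.
by apply: (iffP is_trig_mxP) => h i j /h; rewrite mxE.
Qed.

Lemma lower_triE A : lower_tri A = upper_tri A^T.
Proof. by rewrite /upper_tri trmxK. Qed.

Lemma upper_mul A B : upper_tri A -> upper_tri B -> upper_tri (A *m B).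
Proof.
move=> /upperP uA /upperP uB; apply/upperP => i j lt_ji.
rewrite mxE big1 // => k _; have [le_ik|lt_ki] := leqP i k.
  by rewrite uB ?mulr0 // (leq_trans lt_ji).
by rewrite uA ?mul0r.
Qed.

Lemma upper_mul_diag A B i :
  upper_tri A -> upper_tri B -> (A *m B) i i = A i i * B i i.
Proof.
move=> /upperP uA /upperP uB; rewrite mxE (bigD1 i) //= big1 ?addr0 // => k.
rewrite neq_ltn => /orP[lt|lt]; first by rewrite uA ?mul0r.
by rewrite uB ?mulr0.
Qed.

Lemma upper_det A : upper_tri A -> \det A = \prod_i A i i.
Proof.
by move=> uA; rewrite -det_tr det_trig //; apply: eq_bigr => i _; rewrite mxE.
Qed.

Lemma upper_unit_diag A i : upper_tri A -> A \in unitmx -> A i i != 0.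
Proof.
move=> uA; rewrite unitmxE unitfE upper_det // => /prodf_neq0; exact.
Qed.

Definition unip_upper A : Prop :=
  forall i j : 'I_n, (j <= i)%N -> A i j = (i == j)%:R.

Definition unip_lower A : Prop := unip_upper A^T.

Lemma unip_upper_tri A : unip_upper A -> upper_tri A.
Proof.
move=> uA; apply/upperP => i j lt_ji.
by rewrite uA 1?ltnW // -val_eqE /= gtn_eqF.
Qed.

Lemma unip_upperI A :
  upper_tri A -> (forall i, A i i = 1) -> unip_upper A.
Proof.
move=> /upperP uA dA i j; rewrite leq_eqVlt => /orP[/eqP/val_inj->|lt_ji].
  by rewrite dA eqxx.
by rewrite uA // -val_eqE /= gtn_eqF.
Qed.

Lemma unip_upper_unit A : unip_upper A -> A \in unitmx.
Proof.
move=> uA; rewrite unitmxE upper_det ?unip_upper_tri // big1 ?unitr1 // => i _.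
by rewrite uA ?eqxx.
Qed.

Lemma unip_lower_unit A : unip_lower A -> A \in unitmx.
Proof. by move/unip_upper_unit; rewrite unitmx_tr. Qed.

Lemma unip_lowerE A (i j : 'I_n) : unip_lower A -> (i <= j)%N -> A i j = (i == j)%:R.
Proof. by move=> uA le_ij; have := uA j i le_ij; rewrite mxE eq_sym. Qed.

Lemma unip_lower_tri A : unip_lower A -> lower_tri A.
Proof. by move/unip_upper_tri; rewrite lower_triE. Qed.

End Triangular.

Section FlagEquality.
Variables (K : fieldType) (n : nat).
Implicit Types (A B : 'M[K]_n).

Lemma col_mulmx A B j : col j (A *m B) = A *m col j B.
Proof. by rewrite !colE mulmxA. Qed.

Lemma invmx_mul A B : A \in unitmx -> B \in unitmx ->
  invmx (A *m B) = invmx B *m invmx A.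
Proof.
move=> uA uB; have uAB : A *m B \in unitmx by rewrite unitmx_mul uA.
apply: (can_inj (mulKmx uAB)).
by rewrite mulmxV // mulmxA -[A *m B *m _]mulmxA mulmxV // mulmx1 mulmxV.
Qed.

(** Membership in the span of the first [i] columns of an invertible matrix is
    read off from the coordinates with respect to its columns; this turns
    statements about flags into statements about triangular matrices. *)
Lemma mem_column_spans A (i : 'I_n.+1) x : A \in unitmx ->
  (x \in column_spans A i) =
  [forall r : 'I_n, (i <= r)%N ==> ((invmx A *m x) r 0 == 0)].
Proof.
move=> uA; rewrite ffunE.
have colE k : invmx A *m col k A = col k 1%:M.
  by rewrite -col_mulmx mulVmx.
have sz : size (columns A) = n by rewrite size_map size_enum_ord.
have szt : size (take i (columns A)) = i.
  by rewrite size_takel // sz -ltnS.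
have nthE (k : 'I_n) : (columns A)`_k = col k A.
  by rewrite /columns (nth_map k) ?size_enum_ord // nth_ord_enum.
apply/idP/forallP => [xA r|h].
  apply/implyP => le_ir.
  rewrite (coord_span (X := in_tuple (take i (columns A))) xA).
  rewrite mulmx_sumr summxE big1 // => k _.
  have lt_ki : (k < i)%N by rewrite -[X in (_ < X)%N]szt.
  have lt_kn : (k < n)%N by apply: leq_trans lt_ki _; rewrite -ltnS.
  rewrite /= nth_take // (nthE (Ordinal lt_kn)) -scalemxAr colE !mxE.
  by rewrite -val_eqE /= gtn_eqF ?mulr0 // (leq_trans lt_ki).
rewrite -[x](mulKVmx uA); set y := invmx A *m x in h *.
have -> : A *m y = \sum_k y k 0 *: col k A.
  apply/colP => r; rewrite !mxE summxE; apply: eq_bigr => k _.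
  by rewrite !mxE mulrC.
apply: memv_suml => k _; have [le_ik|lt_ki] := leqP i k.
  by have /implyP/(_ le_ik)/eqP-> := h k; rewrite scale0r mem0v.
rewrite memvZ // memv_span // -nthE -(nth_take _ lt_ki) mem_nth //.
by rewrite szt.
Qed.

(** [G/B] as a set: two invertible matrices have the same flag exactly when
    they differ by an upper triangular factor. *)
Lemma flag_of_eq (A B : GL K n) :
  flag_of A = flag_of B <-> upper_tri (invmx (val A) *m val B).
Proof.
case: A B => A uA [B uB] /=; split.
  move=> /(congr1 val) /= E; apply/upperP => r c lt_cr.
  have lt_cn : (c.+1 < n.+1)%N by rewrite ltnS.
  have : col c B \in column_spans B (Ordinal lt_cn).
    rewrite mem_column_spans //; apply/forallP => k; apply/implyP => /= lt_ck.
    by rewrite -col_mulmx mulVmx // !mxE -val_eqE /= gtn_eqF.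
  rewrite -E mem_column_spans // => /forallP/(_ r)/implyP/(_ lt_cr).
  by rewrite -col_mulmx mxE => /eqP.
move=> /upperP upAB; apply: val_inj => /=; apply/ffunP => i; apply/esym/eqP.
have /andP[/forallP dA _] := @column_spans_flag _ _ (exist _ A uA).
have /andP[/forallP dB _] := @column_spans_flag _ _ (exist _ B uB).
rewrite eqEdim (eqP (dA i)) (eqP (dB i)) leqnn andbT [X in (X <= _)%VS]ffunE.
apply/span_subvP => x xB.
have le_in : (i <= n)%N by rewrite -ltnS.
have /(nthP 0)[k] := xB.
rewrite size_takel => [lt_ki|]; last by rewrite size_map size_enum_ord.
have lt_kn := leq_trans lt_ki le_in.
rewrite nth_take // (nth_map (Ordinal lt_kn)) ?size_enum_ord //.
rewrite (nth_ord_enum (Ordinal lt_kn) (Ordinal lt_kn)) => <-.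
rewrite mem_column_spans //; apply/forallP => r; apply/implyP => le_ir.
by rewrite -col_mulmx mxE upAB //= (leq_trans lt_ki).
Qed.

Lemma upper_inv A : A \in unitmx -> upper_tri A -> upper_tri (invmx A).
Proof.
move=> uA upA; pose A' : GL K n := exist _ A uA.
pose I' : GL K n := exist _ 1%:M (unitmx1 K n).
have /flag_of_eq E : upper_tri (invmx (val I') *m val A').
  by rewrite /= invmx1 mul1mx.
by have /flag_of_eq := esym E; rewrite /= mulmx1.
Qed.

Lemma unip_upper_inv A : unip_upper A -> unip_upper (invmx A).
Proof.
move=> uA; have unA := unip_upper_unit uA; have tA := unip_upper_tri uA.
apply: unip_upperI => [|i]; first exact: upper_inv.
have := upper_mul_diag i tA (upper_inv unA tA).
by rewrite mulmxV // uA // eqxx mul1r mxE eqxx.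
Qed.

Lemma unip_lower_inv A : unip_lower A -> unip_lower (invmx A).
Proof. by rewrite /unip_lower trmx_inv; apply: unip_upper_inv. Qed.

End FlagEquality.

(** * Reduced words *)

Section Words.
Variable n : nat.
Implicit Types (a : seq 'I_n.-1) (i : 'I_n.-1) (v w : 'S_n).

Definition reduced a : Prop :=
  forall a', word_perm a' = word_perm a -> (size a <= size a')%N.

Lemma perm_length_reduced w (a : (perm_length w).-tuple 'I_n.-1) :
  word_perm a = w -> reduced a.
Proof.
move=> Ea a'; rewrite Ea size_tuple /perm_length => Ea'.
case: ex_minnP => m _; apply; apply/existsP; exists (in_tuple a').
by rewrite Ea'.
Qed.

Lemma simple_reflK i : (simple_refl i * simple_refl i = 1)%g.
Proof. exact: tperm2. Qed.

Lemma simple_reflV i : (simple_refl i)^-1%g = simple_refl i.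
Proof. exact: tpermV. Qed.

Lemma word_perm_rev a : word_perm (rev a) = (word_perm a)^-1%g.
Proof.
elim: a => [|i a IHa]; first by rewrite invg1.
rewrite rev_cons -cats1 word_perm_cat IHa /= /perm_comp mul1g.
by rewrite invMg simple_reflV.
Qed.

Lemma reduced_rev a : reduced a -> reduced (rev a).
Proof.
move=> ra a' Ea'; rewrite size_rev -(size_rev a'); apply: ra.
by rewrite word_perm_rev Ea' word_perm_rev invgK.
Qed.

Lemma reduced_tail i a : reduced (i :: a) -> reduced a.
Proof. by move=> ra a' Ea'; apply: (ra (i :: a')); rewrite /= Ea'. Qed.

Lemma simple_refl_monotone i (x y : 'I_n) :
  (x < y)%N -> (simple_refl i y <= simple_refl i x)%N ->
  x = ord_fst i /\ y = ord_snd i.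
Proof.
have sE (k : 'I_n) : simple_refl i k =
    (if k == i :> nat then i.+1 else if k == i.+1 :> nat then i : nat else k) :> nat.
  rewrite /simple_refl; case: tpermP => [->|->|/eqP + /eqP]; rewrite -?val_eqE /=.
  - by rewrite eqxx.
  - by rewrite eqxx gtn_eqF.
  - by move=> /negPf-> /negPf->.
rewrite !sE; do !case: ifP => //; move=> *; split; apply: val_inj => /=; lia.
Qed.

(** Exchange condition: the inverse permutation reverses [x < y], so when the two
    values are followed through the word, some letter is the first to swap their
    order. That letter can be deleted at the cost of the transposition. *)
Lemma exchange a (x y : 'I_n) : (x < y)%N ->
  ((word_perm a)^-1%g y <= (word_perm a)^-1%g x)%N ->
  exists2 a', word_perm a' = perm_comp (tperm x y) (word_perm a) &
              (size a' < size a)%N.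
Proof.
elim: a x y => [|i a IHa] x y lt_xy /=.
  by rewrite invg1 !perm1 leqNgt lt_xy.
rewrite /perm_comp invMg !permM simple_reflV => le_yx.
have [lt_s|le_s] := ltnP (simple_refl i x) (simple_refl i y).
  have [a' Ea' sa'] := IHa _ _ lt_s le_yx.
  exists (i :: a'); rewrite //= Ea' /perm_comp -!mulgA; congr (_ * _)%g.
  by rewrite -tpermJ conjgE simple_reflV -!mulgA simple_reflK mulg1.
have [-> ->] := simple_refl_monotone lt_xy le_s.
by exists a; rewrite // -mulgA [(_ * tperm _ _)%g]simple_reflK mulg1.
Qed.

Lemma reduced_ascent i a : reduced (i :: a) ->
  ((word_perm a)^-1%g (ord_fst i) < (word_perm a)^-1%g (ord_snd i))%N.
Proof.
move=> ra; rewrite ltnNge; apply/negP => le_si.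
have lt_i : (ord_fst i < ord_snd i)%N by rewrite /=.
have [a' Ea' sa'] := exchange lt_i le_si.
by have := ra a' Ea'; rewrite /= leqNgt ltnS ltnW.
Qed.

Lemma longest_permE (i : 'I_n) : longest_perm n i = rev_ord i.
Proof. by rewrite permE. Qed.

Lemma longest_permK : (longest_perm n * longest_perm n)%g = 1%g.
Proof. by apply/permP => i; rewrite permM !longest_permE rev_ordK perm1. Qed.

Lemma longest_permV : (longest_perm n)^-1%g = longest_perm n.
Proof. by apply/eqP; rewrite eq_invg_mul longest_permK. Qed.

End Words.

(** * Braid matrices *)

Section PermMatrices.
Variables (K : fieldType) (n : nat).
Implicit Types (A : 'M[K]_n) (v w : 'S_n).
Local Notation pmx := (@pmx K n).
Local Notation w0 := (longest_perm n).

Lemma pmx_comp v w : pmx (perm_comp v w) = pmx v *m pmx w.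
Proof. by rewrite /pmx /Defs.pmx /perm_comp invMg perm_mxM. Qed.

Lemma pmx1 : pmx 1 = 1%:M.
Proof. by rewrite /Defs.pmx invg1 perm_mx1. Qed.

Lemma pmx_unit v : pmx v \in unitmx.
Proof. exact: unitmx_perm. Qed.

Lemma pmxV v : pmx v *m pmx v^-1 = 1%:M.
Proof. by rewrite -pmx_comp /perm_comp mulVg pmx1. Qed.

Lemma pmxVl v : pmx v^-1 *m pmx v = 1%:M.
Proof. by rewrite -pmx_comp /perm_comp mulgV pmx1. Qed.

Lemma invmx_pmx v : invmx (pmx v) = pmx v^-1.
Proof.
by apply: (can_inj (mulKmx (pmx_unit v))); rewrite mulmxV ?pmx_unit // pmxV.
Qed.

Lemma tr_pmx v : (pmx v)^T = pmx v^-1.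
Proof. by rewrite /Defs.pmx tr_perm_mx. Qed.

Lemma pmx_mull v A i j : (pmx v *m A) i j = A (v^-1%g i) j.
Proof. by rewrite /Defs.pmx -row_permE mxE. Qed.

Lemma pmx_mulr v A i j : (A *m pmx v) i j = A i (v j).
Proof. by rewrite /Defs.pmx -col_permE mxE. Qed.

Lemma pmx_w0K : pmx w0 *m pmx w0 = 1%:M.
Proof. by rewrite -pmx_comp /perm_comp longest_permK pmx1. Qed.

Lemma w0_conjE A i j :
  (pmx w0 *m A *m pmx w0) i j = A (rev_ord i) (rev_ord j).
Proof. by rewrite pmx_mulr pmx_mull longest_permV !longest_permE. Qed.

Lemma w0_conj_upper A : upper_tri (pmx w0 *m A *m pmx w0) = lower_tri A.
Proof.
rewrite lower_triE; apply/upperP/upperP => h i j lt_ji.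
  rewrite mxE; have := h (rev_ord j) (rev_ord i).
  rewrite w0_conjE !rev_ordK; apply.
  by rewrite /=; have := ltn_ord j; have := ltn_ord i; lia.
rewrite w0_conjE; have := h (rev_ord j) (rev_ord i); rewrite mxE; apply.
by rewrite /=; have := ltn_ord j; have := ltn_ord i; lia.
Qed.

Lemma w0_conjK A : pmx w0 *m (pmx w0 *m A *m pmx w0) *m pmx w0 = A.
Proof. by rewrite !mulmxA pmx_w0K mul1mx -mulmxA pmx_w0K mulmx1. Qed.

Lemma w0_conj_unip_lower A : unip_upper A ->
  unip_lower (pmx w0 *m A *m pmx w0).
Proof.
move=> uA i j le_ji; rewrite mxE w0_conjE uA.
  by rewrite (inj_eq rev_ord_inj) eq_sym.
by rewrite /=; have := ltn_ord j; have := ltn_ord i; lia.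
Qed.

End PermMatrices.

Section BraidWords.
Variables (K : fieldType) (n : nat).
Implicit Types (A : 'M[K]_n) (i : 'I_n.-1) (a : seq 'I_n.-1).
Local Notation pmx := (@pmx K n).
Implicit Type s : seq ('I_n.-1 * K).

(** Letters are kept together with their parameters, so that recursion and
    reversal act on both at once. *)
Definition braid_word_mx s : 'M[K]_n :=
  foldr (fun p M => elem_braid_mx p.1 p.2 *m M) 1%:M s.

Lemma braid_word_mx_unit s : braid_word_mx s \in unitmx.
Proof.
elim: s => [|p s IHs] /=; first exact: unitmx1.
by rewrite unitmx_mul elem_braid_mx_unit.
Qed.

Lemma braid_word_mx_cat s s' :
  braid_word_mx (s ++ s') = braid_word_mx s *m braid_word_mx s'.
Proof.
elim: s => [|p s IHs] /=; first by rewrite mul1mx.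
by rewrite IHs mulmxA.
Qed.

Lemma elem_braid_mx_tr i (z : K) : (elem_braid_mx i z)^T = elem_braid_mx i z.
Proof.
apply/matrixP => r c; rewrite !mxE.
have ne : (ord_snd i == ord_fst i) = false by rewrite -val_eqE /= gtn_eqF.
have ne' : (ord_fst i == ord_snd i) = false by rewrite eq_sym.
case: (eqVneq r (ord_fst i)) => [->|rf]; case: (eqVneq c (ord_fst i)) => [->|cf];
case: (eqVneq r (ord_snd i)) => [rs|rs]; case: (eqVneq c (ord_snd i)) => [cs|cs];
  rewrite ?rs ?cs ?ne ?ne' ?eqxx //= 1?eq_sym //.
Qed.

Lemma braid_word_mx_tr s : (braid_word_mx s)^T = braid_word_mx (rev s).
Proof.
elim: s => [|p s IHs] /=; first by rewrite trmx1.
rewrite trmx_mul IHs elem_braid_mx_tr rev_cons -cats1 braid_word_mx_cat /=.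
by rewrite mulmx1.
Qed.

Lemma elem_braid_mxEr i (z : K) :
  elem_braid_mx i z =
  pmx (simple_refl i) *m (1%:M + z *: delta_mx (ord_fst i) (ord_snd i)).
Proof.
rewrite -elem_braid_mx_tr elem_braid_mxE trmx_mul tr_pmx simple_reflV.
by rewrite linearD linearZ /= trmx1 trmx_delta.
Qed.

Lemma simple_refl_fst i : simple_refl i (ord_fst i) = ord_snd i.
Proof. by rewrite /simple_refl tpermL. Qed.

Lemma simple_refl_snd i : simple_refl i (ord_snd i) = ord_fst i.
Proof. by rewrite /simple_refl tpermR. Qed.

Lemma elem_braid_mulE i z A r c :
  (elem_braid_mx i z *m A) r c =
  A (simple_refl i r) c + (z * A (ord_snd i) c) *+ (r == ord_snd i).
Proof.
rewrite elem_braid_mxEr -mulmxA pmx_mull simple_reflV mulmxDl mul1mx -scalemxAl.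
rewrite mxE; congr (_ + _); rewrite mxE.
rewrite [X in _ * X]mxE (bigD1 (ord_snd i)) //= big1 ?addr0 => [|k nk]; last first.
  by rewrite mxE (negPf nk) andbF mul0r.
rewrite mxE eqxx andbT -{1}(simple_refl_snd i) (inj_eq perm_inj).
by rewrite mulrCA mulr_natl.
Qed.

(** Each factor contributes [w'^-1 (1 + z E_{i,i+1}) w'], where [w'] is the
    permutation of the rest of the word; reducedness puts the entry [z] above
    the diagonal. *)
Lemma braid_word_unip_upper s : reduced (unzip1 s) ->
  unip_upper (pmx (word_perm (unzip1 s))^-1 *m braid_word_mx s).
Proof.
elim: s => [|[i z] s IHs] /=.
  by rewrite mulmx1 invg1 pmx1 => _ r c _; rewrite mxE.
move=> rs r c le_cr; rewrite pmx_mull invgK permM elem_braid_mulE.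
have {}IHs := IHs (reduced_tail rs).
have asc := reduced_ascent rs.
set w := word_perm _ in IHs asc *.
have entry x c' : braid_word_mx s x c' = (pmx w^-1 *m braid_word_mx s) (w^-1%g x) c'.
  by rewrite pmx_mull invgK permKV.
have {1}-> : simple_refl i (simple_refl i (w r)) = w r by rewrite tpermK.
rewrite !entry permK IHs //.
rewrite -{2}(simple_refl_fst i) (inj_eq perm_inj) (canF_eq (permK w)).
case: (r =P w^-1%g _) => [Er|_]; last by rewrite mulr0n addr0.
have lt_c : (c < w^-1%g (ord_snd i))%N by rewrite (leq_ltn_trans le_cr) // Er.
rewrite IHs 1?ltnW // -[w^-1%g _ == _]val_eqE (gtn_eqF lt_c).
by rewrite mulr0 mul0rn addr0.
Qed.

Lemma braid_word_unip_lower s : reduced (unzip1 s) ->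
  unip_lower (braid_word_mx s *m pmx (word_perm (unzip1 s))^-1).
Proof.
move=> rs; have Eu : unzip1 (rev s) = rev (unzip1 s) by rewrite /unzip1 map_rev.
have := @braid_word_unip_upper (rev s).
rewrite Eu => /(_ (reduced_rev rs)).
by rewrite word_perm_rev -braid_word_mx_tr invgK /unip_lower trmx_mul tr_pmx invgK.
Qed.

(** The first parameter is an entry of the matrix: with [w'] the permutation of
    the tail, row [i+1] of [B_i(z)B'] is row [i] of [B'] plus [z] times its row
    [i+1], and in column [w'^-1 (i+1)] these entries of [B'] are [0] and [1]. *)
Fixpoint braid_params a A : seq K :=
  if a is i :: a' then
    let z := A (ord_snd i) ((word_perm a')^-1%g (ord_snd i)) in
    z :: braid_params a' (invmx (elem_braid_mx i z) *m A)
  else [::].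

Lemma braid_paramsK s : reduced (unzip1 s) ->
  braid_params (unzip1 s) (braid_word_mx s) = unzip2 s.
Proof.
elim: s => [|[i z] s IHs] //= rs.
have rs' := reduced_tail rs.
have -> : (elem_braid_mx i z *m braid_word_mx s) (ord_snd i)
   ((word_perm (unzip1 s))^-1%g (ord_snd i)) = z.
  rewrite elem_braid_mulE simple_refl_snd eqxx mulr1n.
  have := braid_word_unip_lower rs'; set w := word_perm _ => uN.
  have entry x y : braid_word_mx s x (w^-1%g y) = (braid_word_mx s *m pmx w^-1) x y.
    by rewrite pmx_mulr.
  rewrite !entry !(unip_lowerE uN) // ?leqnSn //.
  by rewrite -val_eqE /= eqxx mulr1 ltn_eqF ?add0r.
by rewrite mulKmx ?elem_braid_mx_unit // IHs.
Qed.

(** One step of the Bruhat decomposition, [s_i B] inside [B s_i U_i]: the entry of [b]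
    at [(i,i+1)] is cleared by a column operation, after which conjugation by
    [s_i] keeps the matrix upper triangular. *)
Lemma simple_refl_upper i A : A \in unitmx -> upper_tri A ->
  exists z B, [/\ B \in unitmx, upper_tri B &
    pmx (simple_refl i) *m A = B *m elem_braid_mx i z].
Proof.
move=> uA tA; set p := ord_fst i; set q := ord_snd i.
have Ap : A p p != 0 by apply: upper_unit_diag.
pose z := A p q / A p p.
pose B := pmx (simple_refl i) *m A *m invmx (elem_braid_mx i z).
exists z, B; split.
- by rewrite !unitmx_mul pmx_unit uA unitmx_inv elem_braid_mx_unit.
- have EB : pmx (simple_refl i) *m B *m pmx (simple_refl i)
            *m (1%:M + z *: delta_mx p q) = A.
    rewrite -!mulmxA -elem_braid_mxEr /B !mulmxA -!mulmxA mulVmx ?elem_braid_mx_unit //.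
    by rewrite mulmx1 mulmxA -{1}[simple_refl i]simple_reflV pmxVl mul1mx.
  set D := _ *m B *m _ in EB.
  have DE r c : D r c + (z * D r p) *+ (c == q) = A r c.
    rewrite -[in RHS]EB mulmxDr mulmx1 [RHS]mxE; congr (_ + _).
    rewrite -scalemxAr [RHS]mxE [X in _ = _ * X]mxE (bigD1 p) //=.
    rewrite big1 ?addr0 => [|k nk]; last first.
      by rewrite [X in _ * X]mxE (negPf nk) mulr0.
    by rewrite [X in _ = _ * (_ * X)]mxE eqxx /= mulr_natr mulrnAr.
  have lt_pq : (p < q)%N by rewrite /=.
  have Dp r : D r p = A r p.
    by have := DE r p; rewrite -[p == q]val_eqE ltn_eqF // addr0.
  have Dpq : D p q = 0.
    have := DE p q; rewrite eqxx mulr1n Dp /z divfK // => /eqP.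
    by rewrite -subr_eq0 addrK => /eqP.
  have BE r c : B r c = D (simple_refl i r) (simple_refl i c).
    by rewrite /D pmx_mulr pmx_mull simple_reflV !tpermK.
  have tD : upper_tri D.
    apply/upperP => r c lt_cr; have := DE r c.
    rewrite (upperP _ tA) //; case: eqP => [Ec|_]; last by rewrite mulr0n addr0.
    by rewrite Dp (upperP _ tA) ?mulr0 ?addr0 // (ltn_trans lt_pq) // -Ec.
  apply/upperP => r c lt_cr; rewrite BE.
  have [lt_s|le_s] := ltnP (simple_refl i c) (simple_refl i r).
    exact: (upperP _ tD).
  have [-> ->] := simple_refl_monotone lt_cr le_s.
  by rewrite simple_refl_fst simple_refl_snd.
- by rewrite /B mulmxKV ?elem_braid_mx_unit.
Qed.

(** The inclusion of [v B] in the union of the cosets [B B_a(z)] is what makes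
    the parametrizations of the cells onto. *)
Lemma word_upper_factor a A : A \in unitmx -> upper_tri A ->
  exists s B, [/\ unzip1 s = a, B \in unitmx, upper_tri B &
    pmx (word_perm a) *m A = B *m braid_word_mx s].
Proof.
elim: a A => [|i a IHa] A uA tA /=.
  by exists [::], A; rewrite pmx1 mul1mx mulmx1.
have [s [B [Es uB tB EB]]] := IHa A uA tA.
have [z [C [uC tC EC]]] := simple_refl_upper i uB tB.
exists ((i, z) :: s), C; split => //=; first by rewrite Es.
by rewrite pmx_comp -mulmxA EB mulmxA EC -mulmxA.
Qed.

Lemma word_lower_factor a A : A \in unitmx -> lower_tri A ->
  exists s B, [/\ unzip1 s = a, B \in unitmx, lower_tri B &
    A *m pmx (word_perm a) = braid_word_mx s *m B].
Proof.
rewrite lower_triE => uA tA; rewrite -unitmx_tr in uA.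
have [s [B [Es uB tB EB]]] := word_upper_factor (rev a) uA tA.
exists (rev s), B^T; split; rewrite ?unitmx_tr ?lower_triE ?trmxK //.
  by rewrite /unzip1 map_rev -/unzip1 -/(unzip1 s) Es revK.
apply: trmx_inj; rewrite !trmx_mul trmxK braid_word_mx_tr revK tr_pmx.
by rewrite -word_perm_rev EB.
Qed.

End BraidWords.

(** * Rational functions *)

Section RationalFunctions.
Variables (K : fieldType) (m : nat).
Implicit Types (O U : set 'rV[K]_m) (f g : 'rV[K]_m -> K).

(** A single fraction valid on all of [O]; every function needed below has this
    form, which is closed under the field operations without any gluing. *)
Definition rational_on O f : Prop :=
  exists p q : {mpoly K[m]},
    forall x, O x -> q.@[x 0] != 0 /\ f x = p.@[x 0] / q.@[x 0].

Lemma eq_rational O f g :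
  (forall x, O x -> f x = g x) -> rational_on O f -> rational_on O g.
Proof.
by move=> fg [p [q h]]; exists p, q => x Ox; rewrite -fg //; apply: h.
Qed.

Lemma sub_rational O U f : U `<=` O -> rational_on O f -> rational_on U f.
Proof. by move=> UO [p [q h]]; exists p, q => x /UO; apply: h. Qed.

Lemma rational_poly O (p : {mpoly K[m]}) : rational_on O (fun x => p.@[x 0]).
Proof. by exists p, 1 => x _; rewrite meval1 divr1 oner_eq0. Qed.

Lemma rational_const O c : rational_on O (fun=> c).
Proof.
by apply: eq_rational (rational_poly O c%:MP) => x _; rewrite mevalC.
Qed.

Lemma rational_coord O k : rational_on O (fun x => x 0 k).
Proof.
by apply: eq_rational (rational_poly O 'X_k) => x _; rewrite mevalXU.
Qed.

Lemma rational_add O f g :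
  rational_on O f -> rational_on O g -> rational_on O (fun x => f x + g x).
Proof.
move=> [p [q h]] [p' [q' h']]; exists (p * q' + p' * q), (q * q') => x Ox.
have [nq ->] := h x Ox; have [nq' ->] := h' x Ox.
by rewrite mevalD !mevalM mulf_neq0 // addf_div.
Qed.

Lemma rational_mul O f g :
  rational_on O f -> rational_on O g -> rational_on O (fun x => f x * g x).
Proof.
move=> [p [q h]] [p' [q' h']]; exists (p * p'), (q * q') => x Ox.
have [nq ->] := h x Ox; have [nq' ->] := h' x Ox.
by rewrite !mevalM mulf_neq0 // mulf_div.
Qed.

Lemma rational_opp O f : rational_on O f -> rational_on O (fun x => - f x).
Proof.
move=> rf; apply: eq_rational (rational_mul (rational_const O (-1)) rf) => x _.
by rewrite mulN1r.
Qed.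

Lemma rational_inv O f : (forall x, O x -> f x != 0) ->
  rational_on O f -> rational_on O (fun x => (f x)^-1).
Proof.
move=> nf [p [q h]]; exists q, p => x Ox; have [nq E] := h x Ox.
have := nf x Ox; rewrite E invf_div mulf_eq0 invr_eq0 negb_or => /andP[np _].
by [].
Qed.

Lemma rational_sum O I (r : seq I) (F : I -> 'rV[K]_m -> K) :
  (forall i, rational_on O (F i)) -> rational_on O (fun x => \sum_(i <- r) F i x).
Proof.
move=> rF; elim: r => [|i r IHr].
  by apply: eq_rational (rational_const O 0) => x _; rewrite big_nil.
by apply: eq_rational (rational_add (rF i) IHr) => x _; rewrite big_cons.
Qed.

Lemma rational_prod O I (r : seq I) (F : I -> 'rV[K]_m -> K) :
  (forall i, rational_on O (F i)) -> rational_on O (fun x => \prod_(i <- r) F i x).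
Proof.
move=> rF; elim: r => [|i r IHr].
  by apply: eq_rational (rational_const O 1) => x _; rewrite big_nil.
by apply: eq_rational (rational_mul (rF i) IHr) => x _; rewrite big_cons.
Qed.

Lemma rational_exp O f e : rational_on O f -> rational_on O (fun x => f x ^+ e).
Proof.
move=> rf; elim: e => [|e IHe]; first exact: rational_const.
by apply: eq_rational (rational_mul rf IHe) => x _; rewrite exprS.
Qed.

Lemma zariski_openP U :
  (forall x, U x -> exists p : {mpoly K[m]},
     p.@[x 0] != 0 /\ forall y : 'rV[K]_m, p.@[y 0] != 0 -> U y) -> zariski_open U.
Proof.
move=> hU; exists [set p : {mpoly K[m]} | forall y : 'rV[K]_m, p.@[y 0] != 0 -> U y].
apply/seteqP; split=> x /=; first by move=> /hU[p [px pU]]; exists p.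
by move=> [p pU px]; apply: pU.
Qed.

Lemma zariski_openT : @zariski_open K m setT.
Proof.
by apply: zariski_openP => x _; exists 1; rewrite meval1 oner_eq0.
Qed.

Lemma zariski_openI U O :
  zariski_open U -> zariski_open O -> zariski_open (U `&` O).
Proof.
move=> [S ->] [T ->]; apply: zariski_openP => x [[p Sp px] [q Tq qx]].
exists (p * q); rewrite mevalM mulf_neq0 //; split=> // y.
rewrite mevalM mulf_eq0 negb_or => /andP[py qy].
by split; [exists p | exists q].
Qed.

Lemma zariski_open_neq0 O f : zariski_open O -> rational_on O f ->
  zariski_open [set x | O x /\ f x != 0].
Proof.
move=> oO [p [q h]]; have -> : [set x | O x /\ f x != 0] =
    O `&` [set x | p.@[x 0] != 0].
  by apply/seteqP; split=> x /= [Ox]; have [nq ->] := h x Ox;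
    rewrite mulf_eq0 invr_eq0 (negPf nq) orbF.
apply: zariski_openI => //; apply: zariski_openP => x px; exists p; split=> //.
Qed.

End RationalFunctions.

Section RationalMatrices.
Variables (K : fieldType) (m n : nat).
Implicit Types (O : set 'rV[K]_m) (A B : 'rV[K]_m -> 'M[K]_n).

Definition rational_mx_on p q O (A : 'rV[K]_m -> 'M[K]_(p, q)) : Prop :=
  forall i j, rational_on O (fun x => A x i j).

Lemma rational_mx_const p q O (A : 'M[K]_(p, q)) :
  rational_mx_on O (fun=> A).
Proof. by move=> i j; apply: rational_const. Qed.

Lemma rational_mx_mul p q r O (A : 'rV[K]_m -> 'M[K]_(p, q))
    (B : 'rV[K]_m -> 'M[K]_(q, r)) :
  rational_mx_on O A -> rational_mx_on O B -> rational_mx_on O (fun x => A x *m B x).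
Proof.
move=> rA rB i j; apply: eq_rational (rational_sum _ _).
  by move=> x _; rewrite mxE.
by move=> k; apply: rational_mul.
Qed.

Lemma rational_det k O (A : 'rV[K]_m -> 'M[K]_k) :
  rational_mx_on O A -> rational_on O (fun x => \det (A x)).
Proof.
move=> rA; apply: rational_sum => s; apply: rational_mul.
  exact: rational_const.
by apply: rational_prod => i; apply: rA.
Qed.

Lemma rational_adj O A : rational_mx_on O A -> rational_mx_on O (fun x => \adj (A x)).
Proof.
move=> rA i j; suff rC : rational_on O (fun x => cofactor (A x) j i).
  by apply: eq_rational rC => x _; rewrite mxE.
apply: rational_mul; first exact: rational_const.
by apply: rational_det => k l; apply: eq_rational (rA _ _) => x _; rewrite !mxE.
Qed.

Lemma rational_mx_inv O A : (forall x, O x -> A x \in unitmx) ->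
  rational_mx_on O A -> rational_mx_on O (fun x => invmx (A x)).
Proof.
move=> uA rA i j.
have nz x : O x -> \det (A x) != 0 by move=> /uA; rewrite unitmxE unitfE.
apply: eq_rational (rational_mul (rational_inv nz (rational_det rA))
  (rational_adj rA i j)) => x Ox.
by rewrite /invmx uA // [RHS]mxE.
Qed.

End RationalMatrices.

Section Morphisms.
Variable K : fieldType.
Implicit Types X Y Z : space_with_functions K.

(** A map given by a total function but meaningful only on [O]. *)
Definition morphism_on X Y (O : set X) (f : X -> Y) : Prop :=
  forall V : set Y, is_open V ->
    is_open (O `&` f @^-1` V) /\
    (forall h : Y -> K, regular V h -> regular (O `&` f @^-1` V) (h \o f)).

Lemma morphism_onT X Y (f : X -> Y) : morphism_on setT f <-> is_morphism f.
Proof. by split=> mf V /mf; rewrite setTI. Qed.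

Lemma morphism_comp_on X Y Z (O : set Y) (f : X -> Y) (g : Y -> Z) :
  is_morphism f -> morphism_on O g -> morphism_on (f @^-1` O) (g \o f).
Proof.
move=> mf mg V oV; have [oW rW] := mg V oV; have [oU rU] := mf _ oW.
by split=> [|h /rW/rU].
Qed.

Lemma quotient_morphism X T (p : X -> T) :
  @is_morphism K X (quotient_space p) p.
Proof. by move=> V oV; split. Qed.

Lemma morphism_comp X Y Z (f : X -> Y) (g : Y -> Z) :
  is_morphism f -> is_morphism g -> is_morphism (g \o f).
Proof.
by move=> mf /morphism_onT mg; apply/morphism_onT; apply: morphism_comp_on mf mg.
Qed.

Lemma induced_morphism T X (j : T -> X) : @is_morphism K (induced_space j) X j.
Proof.
move=> V oV; split; first by exists V.
by move=> h rh t Vt; exists V, h; split.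
Qed.

Lemma eq_morphism_on_induced T X Y (j : T -> X) (O : set (induced_space j))
    (f g : induced_space j -> Y) :
  (forall t, O t -> f t = g t) -> morphism_on O f -> morphism_on O g.
Proof.
move=> fg mf V oV; have [oU rU] := mf V oV.
have E : O `&` g @^-1` V = O `&` f @^-1` V.
  by apply/seteqP; split=> t [Ot /=]; rewrite fg.
rewrite E; split=> // h /rU rh t Ut; have [W [k [oW Wt rk hk]]] := rh t Ut.
exists W, k; split=> // s Us Ws; rewrite -hk //= fg //.
by case: Us.
Qed.

Lemma morphism_on_quotient X T Y (p : X -> T) (O : set T)
    (f : quotient_space p -> Y) :
  morphism_on (p @^-1` O) (f \o p) -> morphism_on (O : set (quotient_space p)) f.
Proof. by []. Qed.

Lemma morphism_on_restrict X Y (O A : set X) (B : set Y) (f : X -> Y)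
    (g : subspace A -> subspace B) :
  morphism_on O f -> A `<=` O -> (forall x : A, val (g x : B) = f (val x)) ->
  is_morphism g.
Proof.
move=> mf AO gf _ [V oV ->]; split.
  have [oU _] := mf V oV; exists (O `&` f @^-1` V) => //.
  apply/seteqP; split=> x /=; rewrite /preimage /= gf; last by case.
  by split=> //; apply: AO; apply: set_mem (valP x).
move=> h rh x; rewrite /preimage /= => Vx.
have [W [k [oW Wx rk hk]]] := rh (g x) Vx.
have [oU rU] := mf W oW; exists (O `&` f @^-1` W), (k \o f); split.
- exact: oU.
- by split; [apply: AO; apply: set_mem (valP x) | rewrite /= -gf].
- exact: rU.
- by move=> y Vy [_ Wy]; rewrite /= hk ?gf.
Qed.

(** Regularity on affine space is local, so that a map into a space carrying
    the structure induced from affine space can be tested there. *)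
Lemma morphism_to_induced m T Y (j : T -> Y)
    (f : affine_space K m -> induced_space j) :
  @is_morphism K (affine_space K m) Y (j \o f) -> is_morphism f.
Proof.
move=> mf _ [V oV ->]; split; first exact: (mf V oV).1.
move=> h rh x Vx; have [W [k [oW Wx rk hk]]] := rh (f x) Vx.
have [oU rU] := mf W oW.
have [U [p [q [oU' Ux pq]]]] := rU k rk x Wx.
exists (((j \o f) @^-1` W) `&` U), p, q; split=> //; first exact: zariski_openI.
move=> y Vy [Wy Uy]; have [nq E] := pq y Wy Uy; split=> //.
by rewrite -E /= hk.
Qed.

(** A fraction in the coordinates of a rational map is again a fraction, hence
    preimages of open sets are open and pullbacks of regular functions are
    regular. *)
Lemma rational_morphism_on m k (O : set 'rV[K]_m) (f : 'rV[K]_m -> 'rV[K]_k) :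
  zariski_open O -> rational_mx_on O f ->
  @morphism_on (affine_space K m) (affine_space K k) O f.
Proof.
move=> oO rf.
have rp (p : {mpoly K[k]}) : rational_on O (fun x => p.@[f x 0]).
  apply: eq_rational (rational_sum _ _) => [x _|mn]; first by rewrite mevalE.
  apply: rational_mul; first exact: rational_const.
  by apply: rational_prod => i; apply: rational_exp; apply: rf.
have oV V : zariski_open V -> zariski_open (O `&` f @^-1` V).
  move=> [S ->]; apply: zariski_openP => x [Ox [p Sp px]].
  have [T ET] := zariski_open_neq0 oO (rp p).
  have TE y : (O y /\ p.@[f y 0] != 0) = (exists2 q, T q & q.@[y 0] != 0).
    by have /= := congr1 (@^~ y) ET.
  have [q Tq qx] : exists2 q, T q & q.@[x 0] != 0 by rewrite -TE.
  exists q; split=> // y qy.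
  have [Oy py] : O y /\ p.@[f y 0] != 0 by rewrite TE; exists q.
  by split=> //; exists p.
move=> V openV; split; first exact: oV.
move=> h rh x [Ox Vx]; have [W [p [q [oW Wx pq]]]] := rh (f x) Vx.
pose U := O `&` f @^-1` (V `&` W).
have UO : U `<=` O by move=> y [].
have [p' [q' pq']] : rational_on U (h \o f).
  have nq y : U y -> q.@[f y 0] != 0 by move=> [_ [Vy Wy]]; have [] := pq _ Vy Wy.
  apply: eq_rational (rational_mul (sub_rational UO (rp p))
    (rational_inv nq (sub_rational UO (rp q)))) => y [_ [Vy Wy]] /=.
  by have [_ ->] := pq _ Vy Wy.
exists U, p', q'; split=> //; first exact/oV/zariski_openI.
by move=> y _; apply: pq'.
Qed.

End Morphisms.

(** * Coordinates on the big cell *)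

Section BigCell.
Variables (K : fieldType) (n : nat).
Implicit Types (A L U : 'M[K]_n) (i j : 'I_n).

Definition head_cols j A : 'M[K]_n :=
  \matrix_(r, c) if (c <= j)%N then A r c else (r == c)%:R.

(** The determinant of [head_cols j A] is the leading minor of size [j + 1], so
    this is the open set [U_- B]. *)
Definition big_cell A : Prop := forall j, head_cols j A \in unitmx.

(** The lower triangular factor in [A = L U]. Since [L e_j] is [e_j] plus a
    combination of the [e_i] with [i > j], and the latter are columns of
    [head_cols j A], its entries are those of the inverse of that matrix up to
    sign; no other minors are needed. *)
Definition lower_factor A : 'M[K]_n :=
  \matrix_(i, j) if (j < i)%N then - invmx (head_cols j A) i j else (i == j)%:R.

Lemma head_cols_mulr j A U : upper_tri U ->
  head_cols j (A *m U) = head_cols j A *m head_cols j U.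
Proof.
move=> /upperP uU; apply/matrixP => r c; rewrite !mxE.
have [le_cj|lt_jc] := leqP c j; apply/esym.
  apply: eq_bigr => k _; rewrite !mxE le_cj.
  have [//|lt_jk] := leqP k j; rewrite uU ?mulr0 //.
  exact: leq_ltn_trans le_cj lt_jk.
rewrite (bigD1 c) //= !mxE leqNgt lt_jc /= eqxx mulr1 big1 ?addr0 // => k nk.
by rewrite !mxE [(c <= j)%N]leqNgt lt_jc /= (negPf nk) mulr0.
Qed.

Lemma head_cols_upper j U : upper_tri U -> upper_tri (head_cols j U).
Proof.
move=> /upperP uU; apply/upperP => r c lt_cr; rewrite mxE uU //.
by rewrite -val_eqE /= gtn_eqF // if_same.
Qed.

Lemma head_cols_upper_unit j U : upper_tri U -> U \in unitmx ->
  head_cols j U \in unitmx.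
Proof.
move=> tU uU; rewrite unitmxE upper_det ?head_cols_upper // unitfE.
apply/prodf_neq0 => k _; rewrite mxE; case: ifP => _.
  exact: upper_unit_diag.
by rewrite eqxx oner_eq0.
Qed.

Lemma big_cell_mulr A U : upper_tri U -> U \in unitmx ->
  big_cell A -> big_cell (A *m U).
Proof.
move=> tU uU bA j; rewrite head_cols_mulr // unitmx_mul bA.
exact: head_cols_upper_unit.
Qed.

(** The rows of [head_cols j U] below the [j]-th are those of the identity, so
    the rows of the inverse that enter [lower_factor] do not see [U]. *)
Lemma lower_factor_mulr A U : upper_tri U -> U \in unitmx ->
  big_cell A -> lower_factor (A *m U) = lower_factor A.
Proof.
move=> tU uU bA; apply/matrixP => i j; rewrite !mxE.
case: ifP => // lt_ji; congr (- _).
have uHU := head_cols_upper_unit j tU uU.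
rewrite head_cols_mulr // invmx_mul //.
have rowE : row i (head_cols j U) = row i 1%:M.
  apply/rowP => c; rewrite !mxE; case: leqP => // le_cj.
  rewrite (upperP _ tU) ?(leq_ltn_trans le_cj) //.
  by rewrite -val_eqE /= gtn_eqF // (leq_ltn_trans le_cj).
have rowVE : row i (invmx (head_cols j U)) = row i 1%:M.
  apply: (can_inj (mulmxK uHU)).
  by rewrite -!row_mul mulVmx // mul1mx rowE.
by have := congr1 (fun R => (R *m invmx (head_cols j A)) 0 j) rowVE;
  rewrite /= -!row_mul mul1mx [LHS]mxE => ->; rewrite mxE.
Qed.

Lemma head_cols_unip_lower j L : unip_lower L -> unip_lower (head_cols j L).
Proof.
move=> uL c r le_rc; rewrite !mxE; case: ifP => _.
  by rewrite unip_lowerE // eq_sym.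
by rewrite eq_sym.
Qed.

Lemma unip_lower_big_cell L : unip_lower L -> big_cell L.
Proof. by move=> uL j; apply/unip_lower_unit/head_cols_unip_lower. Qed.

Lemma lower_factor_unip_lower A : unip_lower (lower_factor A).
Proof.
by move=> i j le_ji; rewrite !mxE ltnNge le_ji /= eq_sym.
Qed.

Lemma lower_factor_id L : unip_lower L -> lower_factor L = L.
Proof.
move=> uL; apply/matrixP => i j; rewrite mxE; case: ltnP => [lt_ji|le_ij]; last first.
  by rewrite unip_lowerE.
have uH := unip_lower_big_cell uL j.
pose y : 'cV[K]_n := \col_r ((r == j)%:R *+ 2 - L r j).
(* [head_cols j L] fixes [L e_j - e_j], which lives in rows below [j], and sends
   [e_j] to [L e_j]; hence it sends [2 e_j - L e_j] to [e_j]. *)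
suff Ey : head_cols j L *m y = col j 1%:M.
  have := congr1 (fun v => (invmx (head_cols j L) *m v) i 0) Ey.
  rewrite /= mulKmx // -col_mulmx mulmx1 [RHS]mxE => <-.
  by rewrite mxE -val_eqE /= gtn_eqF // mul0rn sub0r opprK.
apply/colP => r; rewrite [RHS]mxE mxE.
have yE k : y k 0 = (k == j)%:R - (if (k <= j)%N then 0 else L k j).
  rewrite mxE; case: leqP => [le_kj|lt_jk].
    by rewrite unip_lowerE // mulr2n addrK subr0.
  by rewrite -val_eqE /= gtn_eqF // mul0rn.
under eq_bigr do rewrite yE mulrBr.
rewrite sumrB (bigD1 j) //= eqxx mulr1 big1 ?addr0 => [|k nk]; last first.
  by rewrite (negPf nk) mulr0.
rewrite [head_cols j L r j]mxE leqnn.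
have -> : \sum_k head_cols j L r k * (if (k <= j)%N then 0 else L k j) =
    if (r <= j)%N then 0 else L r j.
  rewrite (bigD1 r) //= big1 ?addr0 => [|k nk].
    by rewrite mxE; case: leqP => _; rewrite ?mulr0 // eqxx mul1r.
  rewrite mxE; case: leqP => _; first by rewrite mulr0.
  by rewrite eq_sym (negPf nk) mul0r.
rewrite mxE; case: leqP => [le_rj|lt_jr]; first by rewrite subr0 unip_lowerE.
by rewrite subrr -val_eqE /= gtn_eqF.
Qed.

Lemma rational_head_cols m (O : set 'rV[K]_m) (A : 'rV[K]_m -> 'M[K]_n) j :
  rational_mx_on O A -> rational_mx_on O (fun x => head_cols j (A x)).
Proof.
move=> rA r c.
suff : rational_on O (fun x => if (c <= j)%N then A x r c else (r == c)%:R).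
  by apply: eq_rational => x _; rewrite mxE.
case: (c <= j)%N; [exact: rA | exact: rational_const].
Qed.

Lemma rational_lower_factor m (O : set 'rV[K]_m) (A : 'rV[K]_m -> 'M[K]_n) :
  (forall x, O x -> big_cell (A x)) ->
  rational_mx_on O A -> rational_mx_on O (fun x => lower_factor (A x)).
Proof.
move=> bA rA i j.
suff : rational_on O (fun x =>
    if (j < i)%N then - invmx (head_cols j (A x)) i j else (i == j)%:R).
  by apply: eq_rational => x _; rewrite mxE.
case: (j < i)%N; last exact: rational_const.
apply: rational_opp; apply: rational_mx_inv; last exact: rational_head_cols.
by move=> x /bA.
Qed.

Lemma zariski_open_big_cell m (A : 'rV[K]_m -> 'M[K]_n) :
  rational_mx_on setT A -> zariski_open [set x | big_cell (A x)].
Proof.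
move=> rA.
have rD : rational_on setT (fun x => \prod_j \det (head_cols j (A x))).
  by apply: rational_prod => j; apply/rational_det/rational_head_cols.
have := zariski_open_neq0 (@zariski_openT K m) rD.
congr zariski_open; apply/seteqP; split=> x /=.
  by move=> [_ /prodf_neq0 h] j; rewrite unitmxE unitfE h.
by move=> bA; split=> //; apply/prodf_neq0 => j _; rewrite -unitfE -unitmxE bA.
Qed.

End BigCell.

(** * Parametrized cells *)

Section ParametrizedCells.
Variables (K : fieldType) (n : nat).
Local Notation GL := (GL K n).
Local Notation flag := (flag K n).

(** An isomorphism of affine space onto a cell, whose inverse extends to a
    rational map on an open set of flags. The chart is given on matrices, and its
    third condition makes it descend to flags. *)
Record cell_param p (phi : 'rV[K]_p -> GL) (C : set flag) : Prop := CellParam {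
  cell_rational : rational_mx_on setT (fun z => val (phi z));
  cell_in : forall z, C (flag_of (phi z));
  cell_onto : forall F, C F -> exists z, flag_of (phi z) = F;
  cell_chart : exists (O : set 'M[K]_n) (zeta : 'M[K]_n -> 'rV[K]_p),
    [/\ zariski_open [set x : 'rV[K]_(n * n) | O (vec_mx x)],
        rational_mx_on [set x : 'rV[K]_(n * n) | O (vec_mx x)]
          (fun x => zeta (vec_mx x)),
        forall A B : GL, flag_of A = flag_of B -> O (val A) ->
          O (val B) /\ zeta (val A) = zeta (val B) &
        forall z, O (val (phi z)) /\ zeta (val (phi z)) = z]
}.

Lemma rational_lsubmx p q (O : set 'rV[K]_(p + q)) :
  rational_mx_on O (fun z => lsubmx z).
Proof.
by move=> i j; apply: eq_rational (rational_coord O (lshift q j)) => z _;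
  rewrite mxE ord1.
Qed.

Lemma rational_vec_mx (O : set 'rV[K]_(n * n)) :
  rational_mx_on O (fun x => vec_mx x : 'M[K]_n).
Proof.
by move=> i j; apply: eq_rational (rational_coord O (mxvec_index i j)) => x _;
  rewrite mxE.
Qed.

Lemma flag_of_morphism m (phi : 'rV[K]_m -> GL) :
  rational_mx_on setT (fun z => val (phi z)) ->
  @is_morphism K (affine_space K m) (flag_variety K n) (fun z => flag_of (phi z)).
Proof.
move=> rphi; apply: (@morphism_comp K (affine_space K m) (GL_space K n)
  (flag_variety K n) phi (@flag_of K n)); last exact: quotient_morphism.
apply: morphism_to_induced; apply/morphism_onT; apply: rational_morphism_on.
  exact: zariski_openT.
move=> i k; case/mxvec_indexP: k => r c.
by apply: eq_rational (rphi r c) => z _; rewrite ord1 mxvecE.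
Qed.

Definition flag_rep (F : flag) : GL :=
  xget (exist _ 1%:M (unitmx1 K n)) [set A | flag_of A = F].

Lemma flag_repK A : flag_of (flag_rep (flag_of A)) = flag_of A.
Proof. by rewrite /flag_rep; case: xgetP => [_ -> //|/(_ A)]; case. Qed.

(** If [X] is the set of pairs of parameters of one and the same flag, then
    forgetting the second parameter loses nothing on the intersection of the two
    cells, and both parameters are regular functions there. *)
Lemma richardson_isomorphism p q (phi : 'rV[K]_p -> GL) (psi : 'rV[K]_q -> GL)
    (C1 C2 : set flag) (X : set (affine_space K (p + q))) :
  cell_param phi C1 -> cell_param psi C2 ->
  (forall z : 'rV[K]_(p + q),
     X z <-> flag_of (phi (lsubmx z)) = flag_of (psi (rsubmx z))) ->
  @restricts_to_isomorphism K (affine_space K (p + q)) (flag_variety K n)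
    X (C1 `&` C2) (fun z => flag_of (phi (lsubmx z))).
Proof.
move=> cphi cpsi XE.
have [O1 [zeta1 [oO1 rz1 inv1 zK1]]] := cell_chart cphi.
have [O2 [zeta2 [oO2 rz2 inv2 zK2]]] := cell_chart cpsi.
pose f z := flag_of (phi (@lsubmx K 1 p q z)).
pose r A : 'rV[K]_(p + q) := row_mx (zeta1 A) (zeta2 A).
pose g F := r (val (flag_rep F)).
pose O F := O1 (val (flag_rep F)) /\ O2 (val (flag_rep F)).
have repO A : O1 (val A) -> O2 (val A) -> O (flag_of A).
  by move=> o1 o2; have E := esym (flag_repK A);
    split; [case: (inv1 _ _ E o1) | case: (inv2 _ _ E o2)].
have Of A : O (flag_of A) -> O1 (val A) /\ O2 (val A).
  by move=> [o1 o2]; have E := flag_repK A;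
    split; [case: (inv1 _ _ E o1) | case: (inv2 _ _ E o2)].
have gE A : O (flag_of A) -> g (flag_of A) = r (val A).
  move=> [o1 o2]; have E := flag_repK A; rewrite /g /r.
  by rewrite (inv1 _ _ E o1).2 (inv2 _ _ E o2).2.
have cellO F : C1 F -> C2 F -> O F.
  move=> /(cell_onto cphi)[z1 <-] /(cell_onto cpsi)[z2 E].
  apply: repO; first exact: (zK1 z1).1.
  by case: (inv2 _ _ E (zK2 z2).1).
have cellg F : C1 F -> C2 F -> exists z, [/\ g F = z,
    flag_of (phi (lsubmx z)) = F & flag_of (psi (rsubmx z)) = F].
  move=> C1F C2F; have OF := cellO F C1F C2F.
  have [z1 E1] := cell_onto cphi C1F; have [z2 E2] := cell_onto cpsi C2F.
  exists (row_mx z1 z2); rewrite row_mxKl row_mxKr; split=> //.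
  move: OF; rewrite -E1 => /gE ->; rewrite /r (zK1 z1).2; congr row_mx.
  have E : flag_of (psi z2) = flag_of (phi z1) by rewrite E1 E2.
  by rewrite -(inv2 _ _ E (zK2 z2).1).2 (zK2 z2).2.
have fX z : X z -> (C1 `&` C2) (f z).
  move=> /XE E; split; first exact: (cell_in cphi).
  by rewrite /f E; apply: (cell_in cpsi).
have gX F : (C1 `&` C2) F -> X (g F).
  move=> [C1F C2F]; have [z [-> E1 E2]] := cellg F C1F C2F.
  by apply/XE; rewrite E1 E2.
have fgK F : (C1 `&` C2) F -> f (g F) = F.
  by move=> [C1F C2F]; have [z [-> E1 E2]] := cellg F C1F C2F.
have gfK z : X z -> g (f z) = z.
  move=> Xz; have [C1F C2F] := fX z Xz; move: Xz => /XE E.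
  rewrite gE; last exact: cellO.
  by rewrite /r (zK1 _).2 -(inv2 _ _ (esym E) (zK2 _).1).2 (zK2 _).2 hsubmxK.
pose f' (x : X) : (C1 `&` C2) :=
  exist _ (f (val x)) (mem_set (fX _ (set_mem (valP x)))).
pose g' (F : C1 `&` C2) : X :=
  exist _ (g (val F)) (mem_set (gX _ (set_mem (valP F)))).
exists f' => //; split.
  have mf : morphism_on (setT : set (affine_space K (p + q)))
      (f : affine_space K (p + q) -> flag_variety K n).
    apply/morphism_onT.
    have ml : @is_morphism K (affine_space K (p + q)) (affine_space K p)
        (@lsubmx K 1 p q).
      apply/morphism_onT; apply: rational_morphism_on; first exact: zariski_openT.
      exact: rational_lsubmx.
    exact: morphism_comp ml (flag_of_morphism (cell_rational cphi)).
  exact: morphism_on_restrict mf _ _.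
exists g'; split.
- by move=> x; apply: val_inj; rewrite /= gfK //; apply: set_mem (valP x).
- by move=> F; apply: val_inj; rewrite /= fgK //; apply: set_mem (valP F).
have mg : morphism_on (O : set (flag_variety K n))
    (g : flag_variety K n -> affine_space K (p + q)).
  apply: morphism_on_quotient.
  pose O' : set 'rV[K]_(n * n) := [set x | O1 (vec_mx x)] `&` [set x | O2 (vec_mx x)].
  have mr : @morphism_on K (affine_space K (n * n)) (affine_space K (p + q)) O'
      (fun x => r (vec_mx x)).
    apply: rational_morphism_on; first exact: zariski_openI.
    move=> i k; rewrite /r -[k]splitK; case: (fintype.split k) => k' /=.
      have rO : rational_mx_on O' (fun x => zeta1 (vec_mx x)).
        by move=> ? ?; apply: sub_rational (rz1 _ _) => x [].
      by apply: eq_rational (rO i k') => x _; rewrite row_mxEl.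
    have rO : rational_mx_on O' (fun x => zeta2 (vec_mx x)).
      by move=> ? ?; apply: sub_rational (rz2 _ _) => x [].
    by apply: eq_rational (rO i k') => x _; rewrite row_mxEr.
  have := morphism_comp_on
    (induced_morphism (fun A : GL => mxvec (val A) : affine_space K (n * n))) mr.
  have -> : (fun A : GL => mxvec (val A)) @^-1` O' = @flag_of K n @^-1` O.
    apply/seteqP; split=> A; rewrite /preimage /O' /= mxvecK.
      by move=> [? ?]; apply: repO.
    by move=> /Of.
  apply: eq_morphism_on_induced => A OA.
  by rewrite /= mxvecK gE.
apply: morphism_on_restrict mg _ _ => //.
by move=> F []; apply: cellO.
Qed.
End ParametrizedCells.

(** * Braid parametrizations of cells *)

Section BraidCells.
Variables (K : fieldType) (n : nat).
Local Notation GL := (GL K n).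
Local Notation pmx := (@pmx K n).
Local Notation w0 := (longest_perm n).

(** The cells of [h B h^-1]: Schubert cells for [h = 1], opposite cells for
    [h = w0]. *)
Definition triangular_cell (h v : 'S_n) : set (flag K n) :=
  [set F | exists b c : GL, [/\ upper_tri (pmx h^-1 *m val b *m pmx h),
     upper_tri (val c) & F = flag_of (GL_mul (GL_mul b (GL_perm K v)) c)]].

Lemma schubert_cellE w : @schubert_cell K n w = triangular_cell 1 w.
Proof.
apply/seteqP; split=> F /=.
  move=> [_ [b [c [tb tc ->]]] <-]; exists b, c.
  by rewrite invg1 pmx1 mul1mx mulmx1.
move=> [b [c [tb tc ->]]]; move: tb; rewrite invg1 pmx1 mul1mx mulmx1 => tb.
by exists (GL_mul (GL_mul b (GL_perm K w)) c) => //; exists b, c.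
Qed.

Lemma opposite_cellE u : @opposite_cell K n u = triangular_cell w0 u.
Proof.
apply/seteqP; split=> F /=.
  move=> [_ [b [c [tb tc ->]]] <-]; exists b, c.
  by rewrite longest_permV w0_conj_upper.
move=> [b [c [tb tc ->]]]; move: tb; rewrite longest_permV w0_conj_upper => tb.
by exists (GL_mul (GL_mul b (GL_perm K u)) c) => //; exists b, c.
Qed.

Lemma rational_elem_braid_mx m (O : set 'rV[K]_m) i (f : 'rV[K]_m -> K) :
  rational_on O f -> rational_mx_on O (fun x => @elem_braid_mx K n i (f x)).
Proof.
move=> rf r c.
suff rE : rational_on O (fun x => (1%:M : 'M[K]_n) r (simple_refl i c) +
    f x * (delta_mx (ord_snd i) (ord_fst i) : 'M[K]_n) r (simple_refl i c)).
  apply: eq_rational rE => x _.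
  by rewrite elem_braid_mxE pmx_mulr [RHS]mxE [X in _ = _ + X]mxE.
apply: rational_add; first exact: rational_const.
by apply: rational_mul => //; apply: rational_const.
Qed.

Section Word.
Variables (p : nat) (a : p.-tuple 'I_n.-1).

Definition braid_letters (z : 'rV[K]_p) : seq ('I_n.-1 * K) :=
  [seq (tnth a k, z 0 k) | k <- enum 'I_p].

Lemma braid_mx_word z : braid_mx a z = braid_word_mx (braid_letters z).
Proof.
rewrite /braid_mx /braid_letters enumT [index_enum _]unlock.
by elim: (Finite.enum _) => [|k r IHr]; rewrite ?big_nil // big_cons IHr.
Qed.

Lemma braid_letters1 z : unzip1 (braid_letters z) = a.
Proof. by rewrite /unzip1 -map_comp -[RHS](map_tnth_enum a). Qed.

Lemma braid_letters2 z : unzip2 (braid_letters z) = [seq z 0 k | k <- enum 'I_p].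
Proof. by rewrite /unzip2 -map_comp. Qed.

Definition row_of_seq (s : seq K) : 'rV[K]_p := \row_k nth 0 s k.

Lemma row_of_unzip2 z : row_of_seq (unzip2 (braid_letters z)) = z.
Proof.
apply/rowP => k; rewrite mxE braid_letters2 (nth_map k) ?size_enum_ord //.
by rewrite nth_ord_enum.
Qed.

Lemma braid_lettersK s : unzip1 s = a ->
  braid_letters (row_of_seq (unzip2 s)) = s.
Proof.
move=> Es; have sz : size s = p by rewrite -(size_map fst) -/unzip1 Es size_tuple.
rewrite -[RHS]zip_unzip -[LHS]zip_unzip braid_letters1 Es; congr zip.
rewrite braid_letters2; apply: (@eq_from_nth _ 0).
  by rewrite [LHS]size_map [RHS]size_map size_enum_ord sz.
move=> k; rewrite size_map size_enum_ord => lt_kp.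
rewrite (nth_map (Ordinal lt_kp)) ?size_enum_ord // mxE.
by rewrite (nth_ord_enum (Ordinal lt_kp) (Ordinal lt_kp)).
Qed.

Lemma rational_braid_mx (O : set 'rV[K]_p) :
  rational_mx_on O (fun z => braid_mx a z).
Proof.
suff rs (r : seq 'I_p) : rational_mx_on O (fun z =>
    braid_word_mx [seq (tnth a k, z 0 k) | k <- r]).
  by move=> i j; apply: eq_rational (rs (enum 'I_p) i j) => z _;
    rewrite braid_mx_word.
elim: r => [|k r IHr] /=; first exact: rational_mx_const.
by apply: rational_mx_mul IHr; apply/rational_elem_braid_mx/rational_coord.
Qed.

End Word.

Lemma rational_braid_params m (O : set 'rV[K]_m) (A : 'rV[K]_m -> 'M[K]_n) b k :
  rational_mx_on O A -> rational_on O (fun x => nth 0 (braid_params b (A x)) k).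
Proof.
elim: b A k => [|i b IHb] A k rA /=.
  by apply: eq_rational (rational_const O 0) => x _; rewrite nth_nil.
case: k => [|k] /=; first exact: rA.
apply: IHb; apply: rational_mx_mul => //; apply: rational_mx_inv.
  by move=> x _; apply: elem_braid_mx_unit.
exact/rational_elem_braid_mx/rA.
Qed.

Lemma flag_of_mulr (A B : GL) (U : 'M[K]_n) :
  upper_tri U -> val B = val A *m U -> flag_of A = flag_of B.
Proof.
by move=> tU EB; apply/flag_of_eq; rewrite EB mulmxA mulVmx ?(valP A) // mul1mx.
Qed.

(** The chart at [v]: on the translate [v U_- B] of the big cell, flags have
    unipotent lower triangular coordinates, and it suffices that the parameters
    are rational in these. *)
Lemma cell_param_chart p (phi : 'rV[K]_p -> GL) C (v : 'S_n)
    (zeta : 'M[K]_n -> 'rV[K]_p) :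
  rational_mx_on setT (fun z => val (phi z)) ->
  (forall z, C (flag_of (phi z))) ->
  (forall F, C F -> exists z, flag_of (phi z) = F) ->
  (forall z, unip_lower (pmx v^-1 *m val (phi z))) ->
  (forall z, zeta (pmx v^-1 *m val (phi z)) = z) ->
  (forall m (O : set 'rV[K]_m) (L : 'rV[K]_m -> 'M[K]_n),
     rational_mx_on O L -> (forall x, unip_lower (L x)) ->
     rational_mx_on O (fun x => zeta (L x))) ->
  cell_param phi C.
Proof.
move=> rphi phi_in phi_onto phi_lower zetaK rzeta; split=> //.
pose O : set 'M[K]_n := [set A | big_cell (pmx v^-1 *m A)].
exists O, (fun A => zeta (lower_factor (pmx v^-1 *m A))).
have rA (D : set 'rV[K]_(n * n)) : rational_mx_on D (fun x => pmx v^-1 *m vec_mx x).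
  apply: rational_mx_mul; [exact: rational_mx_const | exact: rational_vec_mx].
split.
- exact: zariski_open_big_cell (rA setT).
- apply: (rzeta _ _ (fun x => lower_factor (pmx v^-1 *m vec_mx x))) => [|x].
    exact: rational_lower_factor.
  exact: lower_factor_unip_lower.
- move=> A B /flag_of_eq tU OA; set U := _ *m _ in tU.
  have EB : val B = val A *m U by rewrite /U mulKVmx ?(valP A).
  have uU : U \in unitmx by rewrite unitmx_mul unitmx_inv (valP A) (valP B).
  rewrite /O /= EB mulmxA; split; first exact: big_cell_mulr.
  by rewrite (lower_factor_mulr tU uU OA).
- move=> z; split; first exact: unip_lower_big_cell.
  by rewrite lower_factor_id.
Qed.

Variables (p : nat) (a : p.-tuple 'I_n.-1).
Hypothesis red_a : reduced a.
Let v := word_perm a.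

Lemma braid_mx_unip_upper z : unip_upper (pmx v^-1 *m braid_mx a z).
Proof.
have := @braid_word_unip_upper K n (braid_letters a z).
by rewrite braid_mx_word braid_letters1; apply.
Qed.

Lemma braid_mx_unip_lower z : unip_lower (braid_mx a z *m pmx v^-1).
Proof.
have := @braid_word_unip_lower K n (braid_letters a z).
by rewrite braid_mx_word braid_letters1; apply.
Qed.

Definition braid_coords (A : 'M[K]_n) : 'rV[K]_p :=
  row_of_seq p (braid_params a A).

Lemma braid_coordsK z : braid_coords (braid_mx a z) = z.
Proof.
rewrite /braid_coords braid_mx_word -{1}(braid_letters1 a z) braid_paramsK.
  exact: row_of_unzip2.
by rewrite braid_letters1.
Qed.

Lemma rational_braid_coords m (O : set 'rV[K]_m) (A : 'rV[K]_m -> 'M[K]_n) :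
  rational_mx_on O A -> rational_mx_on O (fun x => braid_coords (A x)).
Proof.
move=> rA i k.
by apply: eq_rational (rational_braid_params a k rA) => x _; rewrite mxE.
Qed.

(** The cell is [g B v^-1 B]. With [U = v^-1 B_a(z)] upper and [N = B_a(z) v^-1]
    lower unipotent, [g B_a(z)^-1] is both [(g U^-1 g^-1) (g v^-1)], which places
    it in the cell, and [(g v^-1) N^-1], which gives its chart coordinates. *)
Lemma inv_braid_cell_param (g : 'S_n) :
  cell_param (fun z => GL_mul (GL_perm K g) (GL_inv (GL_braid a z)))
             (triangular_cell g (perm_comp g v^-1)).
Proof.
have uB z := @braid_mx_unit K n p a z.
have pmx_vK (A : 'M[K]_n) : pmx (perm_comp g v^-1)^-1 *m (pmx g *m A) = pmx v *m A.
  have -> : (perm_comp g v^-1)^-1%g = perm_comp v g^-1.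
    by rewrite /perm_comp invMg invgK.
  by rewrite pmx_comp !mulmxA -[_ *m pmx g^-1 *m _]mulmxA pmxVl mulmx1.
apply: (cell_param_chart (v := perm_comp g v^-1)
  (zeta := fun L => braid_coords (invmx L *m pmx v))).
- apply: rational_mx_mul; first exact: rational_mx_const.
  by apply: rational_mx_inv; [move=> z _; exact: uB | exact: rational_braid_mx].
- move=> z; have uU := braid_mx_unip_upper z; set U := _ *m _ in uU.
  have ub : pmx g *m invmx U *m pmx g^-1 \in unitmx.
    by rewrite !unitmx_mul !pmx_unit unitmx_inv unip_upper_unit.
  exists (exist (fun M => M \in unitmx) _ ub),
    (exist (fun M => M \in unitmx) _ (unitmx1 K n)); split => /=.
  + rewrite !mulmxA pmxVl mul1mx -mulmxA pmxVl mulmx1.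
    by apply: upper_inv; [exact: unip_upper_unit | exact: unip_upper_tri].
  + by apply/upperP => i j lt_ji; rewrite mxE -val_eqE /= gtn_eqF.
  + congr flag_of; apply: val_inj => /=; rewrite mulmx1 pmx_comp /U.
    rewrite invmx_mul ?pmx_unit // invmx_pmx invgK.
    rewrite -!mulmxA [X in _ = _ *m (_ *m (_ *m X))]mulmxA pmxVl mul1mx.
    by rewrite pmxV mulmx1.
- move=> F [b [c [tb tc ->]]]; set b' := _ *m _ *m _ in tb.
  have ub' : b' \in unitmx by rewrite !unitmx_mul !pmx_unit (valP b).
  have ubV : invmx b' \in unitmx by rewrite unitmx_inv.
  have [s [B [Es uBB tB EB]]] := word_upper_factor a ubV (upper_inv ub' tb).
  exists (row_of_seq p (unzip2 s)).
  apply: (@flag_of_mulr _ _ (invmx B *m val c)).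
    by apply: upper_mul => //; apply: upper_inv.
  have Eb' : b' *m pmx v^-1 = invmx (braid_word_mx s) *m invmx B.
    rewrite -invmx_mul ?braid_word_mx_unit // -EB invmx_mul ?pmx_unit //.
    by rewrite invmxK invmx_pmx.
  rewrite /= braid_mx_word braid_lettersK // pmx_comp.
  by rewrite [RHS]mulmxA -[_ *m invmx B]mulmxA -Eb' /b' !mulmxA pmxV mul1mx.
- move=> z /=; rewrite pmx_vK.
  by have := unip_lower_inv (braid_mx_unip_lower z);
    rewrite invmx_mul ?pmx_unit // invmx_pmx invgK.
- move=> z /=; rewrite pmx_vK invmx_mul ?pmx_unit ?unitmx_inv //.
  by rewrite invmxK invmx_pmx -mulmxA pmxVl mulmx1 braid_coordsK.
- move=> m O L rL uL; apply: rational_braid_coords.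
  apply: rational_mx_mul; last exact: rational_mx_const.
  by apply: rational_mx_inv => // x _; apply: unip_lower_unit.
Qed.

(** The cell is [g B_- v w0 B]. Here [g B_a(z) w0] is [(g N g^-1) (g v w0)], in
    the cell since conjugation by [w0] exchanges upper and lower, and also
    [(g v w0) (w0 U w0)], with chart coordinates [w0 U w0]. *)
Lemma braid_cell_param (g : 'S_n) :
  cell_param (fun z => GL_mul (GL_mul (GL_perm K g) (GL_braid a z)) (GL_perm K w0))
             (triangular_cell (perm_comp g w0) (perm_comp g (perm_comp v w0))).
Proof.
have uB z := @braid_mx_unit K n p a z.
have conjE (A : 'M[K]_n) : pmx (perm_comp g w0)^-1 *m A *m pmx (perm_comp g w0) =
    pmx w0 *m (pmx g^-1 *m A *m pmx g) *m pmx w0.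
  have -> : (perm_comp g w0)^-1%g = perm_comp w0 g^-1.
    by rewrite /perm_comp invMg longest_permV.
  by rewrite !pmx_comp !mulmxA.
have chartK z : pmx (perm_comp g (perm_comp v w0))^-1 *m
    (pmx g *m braid_mx a z *m pmx w0) =
    pmx w0 *m (pmx v^-1 *m braid_mx a z) *m pmx w0.
  have -> : (perm_comp g (perm_comp v w0))^-1%g =
      perm_comp w0 (perm_comp v^-1 g^-1).
    by rewrite /perm_comp !invMg longest_permV mulgA.
  by rewrite !pmx_comp !mulmxA -[_ *m pmx g^-1 *m _]mulmxA pmxVl mulmx1.
apply: (cell_param_chart (v := perm_comp g (perm_comp v w0))
  (zeta := fun L => braid_coords (pmx v *m (pmx w0 *m L *m pmx w0)))).
- apply: rational_mx_mul; last exact: rational_mx_const.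
  apply: rational_mx_mul; first exact: rational_mx_const.
  exact: rational_braid_mx.
- move=> z; have uN := braid_mx_unip_lower z; set N := _ *m _ in uN.
  have ub : pmx g *m N *m pmx g^-1 \in unitmx.
    by rewrite !unitmx_mul !pmx_unit uB.
  exists (exist (fun M => M \in unitmx) _ ub),
    (exist (fun M => M \in unitmx) _ (unitmx1 K n)); split => /=.
  + rewrite conjE w0_conj_upper !mulmxA pmxVl mul1mx -mulmxA pmxVl mulmx1.
    exact: unip_lower_tri.
  + by apply/upperP => i j lt_ji; rewrite mxE -val_eqE /= gtn_eqF.
  + congr flag_of; apply: val_inj => /=; rewrite mulmx1 !pmx_comp /N.
    rewrite !mulmxA -[_ *m pmx g^-1 *m _]mulmxA pmxVl mulmx1.
    by rewrite -[_ *m pmx v^-1 *m _]mulmxA pmxVl mulmx1.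
- move=> F [b [c [tb tc ->]]]; move: tb; rewrite conjE w0_conj_upper.
  set b' := _ *m _ *m _ => tb.
  have ub' : b' \in unitmx by rewrite !unitmx_mul !pmx_unit (valP b).
  have [s [B [Es uBB tB EB]]] := word_lower_factor a ub' tb.
  exists (row_of_seq p (unzip2 s)).
  apply: (@flag_of_mulr _ _ (pmx w0 *m B *m pmx w0 *m val c)).
    by apply: upper_mul => //; rewrite w0_conj_upper.
  rewrite /= braid_mx_word braid_lettersK // !pmx_comp.
  rewrite !mulmxA -[_ *m pmx w0 *m pmx w0]mulmxA pmx_w0K mulmx1.
  rewrite -[pmx g *m _ *m B]mulmxA -EB /b' !mulmxA pmxV mul1mx.
  by [].
- by move=> z /=; rewrite chartK; apply/w0_conj_unip_lower/braid_mx_unip_upper.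
- by move=> z /=; rewrite chartK w0_conjK mulmxA pmxV mul1mx braid_coordsK.
- move=> m O L rL _; apply: rational_braid_coords.
  apply: rational_mx_mul; first exact: rational_mx_const.
  apply: rational_mx_mul; last exact: rational_mx_const.
  by apply: rational_mx_mul => //; apply: rational_mx_const.
Qed.

End BraidCells.

Lemma braid_mx_cat (K : fieldType) n p q (a : p.-tuple 'I_n.-1)
    (b : q.-tuple 'I_n.-1) (z : 'rV[K]_(p + q)) :
  braid_mx (cat_tuple a b) z = braid_mx a (lsubmx z) *m braid_mx b (rsubmx z).
Proof.
rewrite [LHS](@big_split_ord 'M[K]_n 1 *%R) /=; congr (_ *m _); apply: eq_bigr => k _.
  by rewrite tnth_lshift mxE.
by rewrite tnth_rshift mxE.
Qed.

Section RichardsonCells.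
Variables (K : fieldType) (n p q : nat) (u w : 'S_n).
Local Notation w0 := (longest_perm n).

Lemma iota_isomorphism (a : p.-tuple 'I_n.-1) (b : q.-tuple 'I_n.-1) :
  reduced a -> reduced b ->
  word_perm a = w -> word_perm b = perm_comp u^-1 w0 ->
  restricts_to_isomorphism (@braid_variety K n _ (cat_tuple a b) w0)
    (@open_richardson K n u^-1 w^-1) (@iota_map K n _ _ a).
Proof.
move=> ra rb Ea Eb.
have E1 : perm_comp 1 (perm_comp (perm_comp u^-1 w0) w0) = u^-1%g.
  by rewrite /perm_comp mulg1 mulgA longest_permK mul1g.
have E2 : perm_comp 1 w^-1 = w^-1%g by rewrite /perm_comp mulg1.
have E3 : perm_comp 1 w0 = w0 by rewrite /perm_comp mulg1.
have := inv_braid_cell_param K ra 1; have := braid_cell_param K rb 1.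
rewrite Ea Eb E1 E2 E3 => cpsi cphi.
rewrite /open_richardson schubert_cellE opposite_cellE.
have -> : @iota_map K n _ q a =
    fun z => flag_of (GL_mul (GL_perm K 1) (GL_inv (GL_braid a (lsubmx z)))).
  apply: boolp.funext => z; congr flag_of; apply: val_inj => /=.
  by rewrite pmx1 mul1mx.
apply: (richardson_isomorphism cphi cpsi) => z.
by rewrite flag_of_eq /= pmx1 !mul1mx invmxK mulmxA -braid_mx_cat.
Qed.

Lemma jmath_isomorphism (b : p.-tuple 'I_n.-1) (c : q.-tuple 'I_n.-1) :
  reduced b -> reduced c ->
  word_perm b = perm_comp u^-1 w0 -> word_perm c = perm_star w ->
  restricts_to_isomorphism (@braid_variety K n _ (cat_tuple b c) w0)
    (@open_richardson K n u w) (@jmath_map K n _ _ b).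
Proof.
move=> rb rc Eb Ec.
have E1 : perm_comp w0 (perm_comp u^-1 w0)^-1 = u.
  by rewrite /perm_comp invMg invgK longest_permV -mulgA longest_permK mulg1.
have E2 : perm_comp w0 (perm_comp (perm_star w) w0) = w.
  rewrite /perm_star /perm_comp -!mulgA longest_permK mulg1 mulgA.
  by rewrite longest_permK mul1g.
have E3 : perm_comp w0 w0 = 1%g := longest_permK n.
have := inv_braid_cell_param K rb w0; have := braid_cell_param K rc w0.
rewrite Eb Ec E1 E2 E3 => cpsi cphi.
rewrite /open_richardson schubert_cellE opposite_cellE.
rewrite [X in restricts_to_isomorphism _ X]setIC.
apply: (richardson_isomorphism cphi cpsi) => z.
rewrite flag_of_eq /= invmx_mul ?pmx_unit ?unitmx_inv ?braid_mx_unit //.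
rewrite invmxK invmx_pmx longest_permV !mulmxA -[_ *m pmx K w0 *m pmx K w0]mulmxA.
by rewrite pmx_w0K mulmx1 -braid_mx_cat.
Qed.

End RichardsonCells.

Theorem corollary4p6 (R : realType) (n : nat) (u w : 'S_n)
  (a : (perm_length w).-tuple 'I_n.-1)
  (b : (perm_length (perm_comp u^-1 (longest_perm n))).-tuple 'I_n.-1)
  (c : (perm_length (perm_star w)).-tuple 'I_n.-1)
  (le_uw : bruhat_le u w)
  (red_a : word_perm a = w)
  (red_b : word_perm b = perm_comp u^-1 (longest_perm n))
  (red_c : word_perm c = perm_star w) :
  restricts_to_isomorphism
    (@braid_variety R[i] n _ (cat_tuple a b) (longest_perm n))
    (@open_richardson R[i] n u^-1 w^-1)
    (@iota_map R[i] n _ _ a) /\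
  restricts_to_isomorphism
    (@braid_variety R[i] n _ (cat_tuple b c) (longest_perm n))
    (@open_richardson R[i] n u w)
    (@jmath_map R[i] n _ _ b).
Proof.
have ra := perm_length_reduced red_a; have rb := perm_length_reduced red_b.
have rc := perm_length_reduced red_c; split.
  exact: (@iota_isomorphism (R[i] : fieldType) n _ _ u w a b ra rb red_a red_b).
exact: (@jmath_isomorphism (R[i] : fieldType) n _ _ u w b c rb rc red_b red_c).
Qed.
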